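(* For all $u,v\in\mathbb{Q}\langle\mathcal{B}\rangle^{0}$, $$u\odot v-u*v\in I^{\mathrm{alg}}_{\mathrm{CF}},$$ where $\odot$ denotes the product in the symmetric algebra $\mathcal{S}(\mathbb{Q}\langle\mathcal{B}\rangle^{0})$ and $*$ is the stuffle product.
   Context: **Words.** $\mathbb{Q}\langle\mathcal{B}\rangle$ is the free noncommutative $\mathbb{Q}$-algebra on $\mathcal{B}=\{b_0,b_1,b_2,\dots\}$ with empty word $1$; $\mathbb{Q}\langle\mathcal{B}\rangle^{0}$ is the subspace spanned by $1$ and all words not ending with $b_0$. The stuffle product $*$ on $\mathbb{Q}\langle\mathcal{B}\rangle$ is the $\mathbb{Q}$-bilinear map with $1*u=u*1=u$ and $(b_iu)*(b_jv)=b_i(u*b_jv)+b_j(b_iu*v)+b_{i+j}(u*v)$ for $i,j\ge0$ (it preserves $\mathbb{Q}\langle\mathcal{B}\rangle^{0}$). Every $u\in\mathbb{Q}\langle\mathcal{B}\rangle$ is uniquely $u=u_0+u_1*b_0+\cdots+u_k*b_0^{*k}$ with $u_j\in\mathbb{Q}\langle\mathcal{B}\rangle^{0}$; put $\operatorname{reg}_*(u)=u_0$. **Formal $q$MPLs.** $q$ is a fixed complex number with $0<|q|<1$. For $X\subset\mathbb{Z}$, $q^X=\{q^n: n\in X\}$. $\hat{\mathcal{F}}$ is the set of formal symbols $\mathbb{L}_{k_1,\dots,k_d}(x_1,\dots,x_d)$ with $d\ge0$, $k_i\in\mathbb{Z}_{\ge1}$, $x_i\in\{z^hq^m: h\in\{0,\pm1\},\,m\in\mathbb{Z}\}$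 and $x_i\cdots x_d\in zq^{\mathbb{Z}}\cup q^{\mathbb{Z}_{>0}}$ for $1\le i\le d$; the case $d=0$ is written $\mathbb{L}(\emptyset)$. Weight: $k_1+\cdots+k_d$. For $\mathcal{X}\subset\hat{\mathcal{F}}$, $\mathbb{Q}\mathcal{X}$ is the $\mathbb{Q}$-vector space with basis $\mathcal{X}$. Let $\Omega=\bigoplus_{b\in\{0\}\cup q^{\mathbb{Z}}}\mathbb{Q}e_b$, with formal symbols $e_b$. **Single-position difference $D$.** $\mathbb{L}_{k_1,\dots,k_d}(x_1,\dots,x_d)$ and $\mathbb{L}_{k_1,\dots,k_d}(x'_1,\dots,x'_d)$ in $\hat{\mathcal{F}}$ are adjacent if for some $j$: $x_i=x_i'$ for $i\ne j$, $x_j\in zq^{\mathbb{Z}}\cup z^{-1}q^{\mathbb{Z}}$, $x_j/x_j'\in\{q^{\pm1}\}$. For adjacent $u=\mathbb{L}_{k_1,\dots,k_d}(x_1,\dots,x_d)$ and $v=\mathbb{L}_{k_1,\dots,k_d}(x_1,\dots,qx_j,\dots,x_d)$ put - if $k_j>1$: $D(u,v)=\mathbb{L}_{k_1,\dots,k_j-1,\dots,k_d}(x_1,\dots,x_d)\otimes e_0$; - if $k_j=1$, $x_j=q^mz$: $D(u,v)=-A\otimes e_{q^{-m}}+B\otimes(e_{q^{-m}}-e_0)$; - if $k_j=1$, $x_j=q^{-m}z^{-1}$: $D(u,v)=A\otimes(e_{q^{-m}}-e_0)-B\otimes e_{q^{-m}}$; where $A=\mathbb{L}_{k_1,\dots,\widehat{k_j},\dots,k_d}(x_1,\dots,x_{j-1}x_j,\dots,x_d)$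 (read as $\mathbb{L}_{k_2,\dots,k_d}(x_2,\dots,x_d)$ if $j=1$) and $B=\mathbb{L}_{k_1,\dots,\widehat{k_j},\dots,k_d}(x_1,\dots,x_jx_{j+1},\dots,x_d)$ (read as $0$ if $j=d$). If instead $v$ is obtained from $u$ by $x_j\mapsto q^{-1}x_j$, put $D(u,v)=-D(v,u)$. **$\mathcal{F}^n$, $\mathcal{F}$, standard path.** For $n\in\mathbb{Z}$, $\mathcal{F}^n$ is the set of $\mathbb{L}_{k_1,\dots,k_d}(x_1,\dots,x_d)\in\hat{\mathcal{F}}$ with $x_i\in\{vq^s: v\in\{1,zq^n,(zq^n)^{-1}\},\,0\le s\le k_i\}$ for all $i$; $\mathcal{F}=\bigcup_n\mathcal{F}^n$. For $u=\mathbb{L}_{k_1,\dots,k_d}(x_1(z),\dots,x_d(z))\in\mathcal{F}$, the level of a $z$-dependent position $i$ is the unique integer $r$ with $x_i=zq^r$ or $x_i=z^{-1}q^{1-r}$. Levels are computed from $u$ and remain fixed. Starting from $u$, replace the $z$-dependent entries one at a time by $x_i(z)\mapsto x_i(zq)$, in increasing order of level, entries of equal level from right to left. The resulting sequence $\operatorname{Std}(u)=(u_0,\dots,u_l)$, $u_0=u(z)$, $u_l=u(zq)$, is the standard path; it consists of elements of $\hat{\mathcal{F}}$ with consecutive ones adjacent. **$\partial$, $S$, $\varphi$.** $\partial\colon\mathbb{Q}\mathcal{F}\to\mathbb{Q}\mathcal{F}\otimes\Omega$ is $\mathbb{Q}$-linear with $\partial(u)=\sum_{i=1}^lD(u_{i-1},u_i)$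 for $u\in\mathcal{F}$, $\operatorname{Std}(u)=(u_0,\dots,u_l)$; it lowers weight by one. $\mathcal{C}$ is the set of $z$-independent elements of $\mathcal{F}$. $\hat{\mathcal{C}}_z=\{\mathbb{L}_{k_1,\dots,k_d}(q^{n_1},\dots,q^{n_{d-1}},zq^{n_d}): d\ge1,n_i\in\mathbb{Z}\}\cup\{\mathbb{L}(\emptyset)\}$ and $\mathcal{C}^n_z=\{\mathbb{L}_{k_1,\dots,k_d}(q^{n_1},\dots,q^{n_{d-1}},zq^{n+n_d}): d\ge1,\,0\le n_i\le k_i\}\cup\{\mathbb{L}(\emptyset)\}$. $S\colon\mathbb{Q}\hat{\mathcal{C}}_z\otimes\Omega\to\mathbb{Q}\hat{\mathcal{C}}_z$ is $\mathbb{Q}$-linear with, for $d\ge1$, $S(\mathbb{L}_{k_1,\dots,k_d}(q^{n_1},\dots,zq^{n_d})\otimes e_0)=\mathbb{L}_{k_1,\dots,k_{d-1},k_d+1}(q^{n_1},\dots,zq^{n_d})$, $S(\mathbb{L}_{k_1,\dots,k_d}(q^{n_1},\dots,zq^{n_d})\otimes e_{q^{-r}})=-\mathbb{L}_{k_1,\dots,k_d,1}(q^{n_1},\dots,q^{n_{d-1}},q^{n_d-r},zq^r)$, $S(\mathbb{L}(\emptyset)\otimes e_{q^{-r}})=-\mathbb{L}_1(zq^r)$, $S(\mathbb{L}(\emptyset)\otimes e_0)=0$. The $\mathbb{Q}$-linear map $\varphi\colon\mathbb{Q}\mathcal{F}\to\mathbb{Q}\mathcal{C}\otimes\mathbb{Q}\hat{\mathcal{C}}_z$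 is defined recursively on weight by $\varphi=(\mathrm{id}_{\mathbb{Q}\mathcal{C}}\otimes S)\circ(\varphi\otimes\mathrm{id}_\Omega)\circ\partial+\mathrm{Const}$, where for $u\in\mathcal{F}$, $\mathrm{Const}(u)=u\otimes\mathbb{L}(\emptyset)$ if $u\in\mathcal{C}$ and $0$ otherwise. One has $\varphi(\mathbb{Q}\mathcal{F}^n)\subset\mathbb{Q}\mathcal{C}\otimes\mathbb{Q}\mathcal{C}^n_z$. **$\pi$, $\pi_z$, $\varphi^\pi$.** For integers $0\le n_i\le k_i$ put $$F(k_1,\dots,k_d;n_1,\dots,n_d)=\sum_{s_1=0}^{k_1-n_1}\cdots\sum_{s_d=0}^{k_d-n_d}\left(\prod_{i=1}^d\binom{k_i-n_i}{s_i}\right)b_{k_1-s_1}\cdots b_{k_d-s_d}.$$ The $\mathbb{Q}$-linear maps $\pi\colon\mathbb{Q}\mathcal{C}\to\mathbb{Q}\langle\mathcal{B}\rangle^0$ and $\pi_z\colon\mathbb{Q}\mathcal{C}^0_z\to\mathbb{Q}\langle\mathcal{B}\rangle$ are $\pi(\mathbb{L}_{k_1,\dots,k_d}(q^{n_1},\dots,q^{n_d}))=\pi_z(\mathbb{L}_{k_1,\dots,k_d}(q^{n_1},\dots,q^{n_{d-1}},zq^{n_d}))=F(k_1,\dots,k_d;n_1,\dots,n_d)$ and $\pi(\mathbb{L}(\emptyset))=\pi_z(\mathbb{L}(\emptyset))=1$. Put $\varphi^\pi=(\pi\otimes\pi_z)\circ\varphi\colon\mathbb{Q}\mathcal{F}^0\to\mathbb{Q}\langle\mathcal{B}\rangle^0\otimes\mathbb{Q}\langle\mathcal{B}\rangle$.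 **Confluence relations.** $\mathcal{G}=\{\mathbb{L}_{k_1,\dots,k_d}(x_1,\dots,x_d)\in\mathcal{F}^0: d=0\text{ or }x_d\ne z\}$; for $u\in\mathbb{Q}\mathcal{G}$, $u|_{z=1}\in\mathbb{Q}\mathcal{C}$ is obtained by setting $z=1$ in all arguments. $\mathcal{S}(\mathbb{Q}\langle\mathcal{B}\rangle^0)$ is the symmetric algebra over $\mathbb{Q}$, with product $\odot$ and unit $1_{\mathcal{S}}$; $1_{\mathbb{Q}\langle\mathcal{B}\rangle^0}$ is the empty word viewed in degree one; $m_\odot(u\otimes v)=u\odot v$. $I^{\mathrm{alg}}_{\mathrm{CF}}$ is the ideal of $\mathcal{S}(\mathbb{Q}\langle\mathcal{B}\rangle^0)$ generated by $1_{\mathbb{Q}\langle\mathcal{B}\rangle^0}-1_{\mathcal{S}}$ and all $m_\odot\circ(\mathrm{id}\otimes\operatorname{reg}_* )\circ\varphi^\pi(u)-\pi(u|_{z=1})$, $u\in\mathbb{Q}\mathcal{G}$. *)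

(* Defs.v *)
From HB Require Import structures.
From mathcomp Require Import all_boot all_order all_algebra.
From mathcomp Require Import finmap.
From mathcomp.multinomials Require Import monalg.
From Stdlib Require Import ClassicalEpsilon.

Set Implicit Arguments.
Unset Strict Implicit.
Unset Printing Implicit Defensive.

Import Order.TTheory GRing.Theory Num.Theory.
Local Open Scope ring_scope.

(* {malg rat[K]} is the Q-vector space with basis K, and the tensor product of
   {malg rat[K]} and {malg rat[L]} is represented as {malg rat[K * L]}. *)

Definition linext (K : choiceType) (V : lmodType rat) (f : K -> V)
    (x : {malg rat[K]}) : V :=
  \sum_(k <- msupp x) x@_k *: f k.

Definition tens (K L : choiceType) (x : {malg rat[K]}) (y : {malg rat[L]}) :
    {malg rat[(K * L)%type]} :=
  \sum_(k <- msupp x) \sum_(l <- msupp y) << x@_k * y@_l *g (k, l) >>.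

Definition tensmap (K L K' L' : choiceType)
    (f : {malg rat[K]} -> {malg rat[K']})
    (g : {malg rat[L]} -> {malg rat[L']}) :
    {malg rat[(K * L)%type]} -> {malg rat[(K' * L')%type]} :=
  linext (fun p => tens (f << p.1 >>) (g << p.2 >>)).

(* The letter b_i is encoded by i; the product of QB is concatenation. *)
Definition word := {fmonom nat}.
Definition QB := {malg rat[word]}.

Definition b (i : nat) : QB := << fmu i >>.

(* The default value 1 of last makes the empty word admissible. *)
Definition admissible (w : word) : bool := last 1%N w != 0%N.

Definition QB0 : {pred QB} := fun x => all admissible (msupp x).

Fixpoint stuffle_word (u : seq nat) : seq nat -> QB :=
  fix aux (v : seq nat) : QB :=
    match u, v with
    | [::], _ => << FMonom v >>
    | _, [::] => << FMonom u >>
    | i :: u', j :: v' =>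
        b i * stuffle_word u' v + b j * aux v'
        + b (i + j)%N * stuffle_word u' v'
    end.

Definition stuffle (x y : QB) : QB :=
  linext (fun u : word => linext (fun v : word => stuffle_word u v) y) x.

Definition stuffle_pow (x : QB) (n : nat) : QB := iter n (stuffle^~ x) 1.

Definition is_reg (u u0 : QB) : Prop :=
  exists us : seq QB,
    [/\ all [in QB0] us,
        u = \sum_(j < size us) stuffle us`_j (stuffle_pow (b 0) j)
      & u0 = us`_0].

Definition reg (u : QB) : QB := epsilon (inhabits (0 : QB)) (is_reg u).

(* The argument z ^ h * q ^ m is encoded by the pair of exponents (h, m), so
   that products of arguments are sums of pairs.  For 0 < |q| < 1 distinct m
   give distinct q ^ m (lemma qpow_inj). *)
Definition arg := (int * int)%type.

(* L_{k_1, ..., k_d}(x_1, ..., x_d) is [:: (k_1, x_1); ...; (k_d, x_d)]. *)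
Definition entry := (nat * arg)%type.
Definition sym := seq entry.

Definition zexp (e : entry) : int := e.2.1.
Definition qexp (e : entry) : int := e.2.2.

Definition entry0 : entry := (0%N, (0, 0)).
Definition ent (u : sym) (j : nat) : entry := nth entry0 u j.

Definition weight (u : sym) : nat := sumn [seq e.1 | e <- u].

(* Membership in z q^Z or in q^{Z_{>0}}. *)
Definition good_prod (x : arg) : bool :=
  (x.1 == 1) || ((x.1 == 0) && (0 < x.2)).

Definition in_Fhat (u : sym) : bool :=
  all (fun e : entry => (0 < e.1)%N && (zexp e \in [:: 0; 1; -1])) u &&
  all (fun i => good_prod (\sum_(e <- drop i u) e.2)) (iota 0 (size u)).

(* z ^ h * q ^ m = v * q ^ s with v = (z * q ^ n) ^ h exactly when
   s = m - h * n. *)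
Definition in_F_ (n : int) (u : sym) : bool :=
  in_Fhat u &&
  all (fun e : entry => 0 <= qexp e - zexp e * n <= e.1%:Z) u.

(* For z-independent symbols membership in F^n does not depend on n. *)
Definition in_C (u : sym) : bool :=
  in_F_ 0 u && all (fun e => zexp e == 0) u.

(* The basis element e_0 of Omega is None, and e_{q^m} is Some m. *)
Definition omega := option int.

Definition mul_arg (u : sym) (j : nat) (x : arg) : sym :=
  set_nth entry0 u j ((ent u j).1, (ent u j).2 + x).

Definition set_index (u : sym) (j : nat) (k : nat) : sym :=
  set_nth entry0 u j (k, (ent u j).2).

Definition del (u : sym) (j : nat) : sym := take j u ++ drop j.+1 u.

Definition symA (u : sym) (j : nat) : {malg rat[sym]} :=
  if j is i.+1 then << del (mul_arg u i (ent u j).2) j >> else << behead u >>.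

Definition symB (u : sym) (j : nat) : {malg rat[sym]} :=
  if (j.+1 < size u)%N then << del (mul_arg u j.+1 (ent u j).2) j >> else 0.

(* D(u, v) for v obtained from u by x_j |-> q x_j. *)
Definition D_up (u : sym) (j : nat) : {malg rat[(sym * omega)%type]} :=
  let e := ent u j in
  let e_ (o : omega) : {malg rat[omega]} := << o >> in
  if (1 < e.1)%N then tens << set_index u j e.1.-1 >> (e_ None)
  else if zexp e == 1 then
    let m := qexp e in
    - tens (symA u j) (e_ (Some (- m)))
    + tens (symB u j) (e_ (Some (- m)) - e_ None)
  else
    let m := - qexp e in
    tens (symA u j) (e_ (Some (- m)) - e_ None)
    - tens (symB u j) (e_ (Some (- m))).

Definition diff_pos (u v : sym) : nat := find (fun p => p.1 != p.2) (zip u v).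

Definition D (u v : sym) : {malg rat[(sym * omega)%type]} :=
  let j := diff_pos u v in
  if v == mul_arg u j (0, 1) then D_up u j else - D_up v j.

(* For x_i = z q^r or x_i = z^{-1} q^{1 - r}, the integer r. *)
Definition level (e : entry) : int :=
  if zexp e == 1 then qexp e else 1 - qexp e.

Definition std_order (u : sym) : seq nat :=
  sort (fun i j => (level (ent u i) < level (ent u j)) ||
                   ((level (ent u i) == level (ent u j)) && (j <= i)%N))
       [seq i <- iota 0 (size u) | zexp (ent u i) != 0].

(* x_j(z) |-> x_j(z q). *)
Definition shift_z (u : sym) (j : nat) : sym :=
  mul_arg u j (0, zexp (ent u j)).

Definition Std (u : sym) : seq sym := u :: scanl shift_z u (std_order u).

Definition partial (u : sym) : {malg rat[(sym * omega)%type]} :=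
  \sum_(i < (size (Std u)).-1)
    D (nth [::] (Std u) i) (nth [::] (Std u) i.+1).

(* S on the basis of (Q \hat C_z) (x) Omega.  For o = Some m the letter is
   e_{q^{-r}} with r = - m. *)
Definition S_basis (w : sym) (o : omega) : {malg rat[sym]} :=
  match w, o with
  | [::], None => 0
  | [::], Some m => - << [:: (1%N, (1, - m))] >>
  | e :: s, None =>
      let: (k, x) := last e s in << rcons (belast e s) (k.+1, x) >>
  | e :: s, Some m =>
      let: (k, (_, n)) := last e s in let r := - m in
      - << rcons (rcons (belast e s) (k, (0, n - r))) (1%N, (1, r)) >>
  end.

Definition Const (u : sym) : {malg rat[(sym * sym)%type]} :=
  if in_C u then << (u, [::]) >> else 0.

(* (id (x) S) o (f (x) id_Omega), for f given on the basis. *)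
Definition applyS (f : sym -> {malg rat[(sym * sym)%type]}) :
    {malg rat[(sym * omega)%type]} -> {malg rat[(sym * sym)%type]} :=
  linext (fun p => linext (fun cw => tens << cw.1 >> (S_basis cw.2 p.2))
                          (f p.1)).

Fixpoint phi_rec (n : nat) (u : sym) : {malg rat[(sym * sym)%type]} :=
  if n is n'.+1 then applyS (phi_rec n') (partial u) + Const u else Const u.

(* partial lowers the weight by one, so the weight bounds the recursion depth;
   lemma phiE gives the recursive equation. *)
Definition phi_sym (u : sym) : {malg rat[(sym * sym)%type]} :=
  phi_rec (weight u) u.
Definition phi : {malg rat[sym]} -> {malg rat[(sym * sym)%type]} :=
  linext phi_sym.

(* F(k_1, ..., k_d; n_1, ..., n_d), for the list of the (k_i, n_i); the
   multiple sum is factored as a product of words. *)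
Definition Fword (kn : seq (nat * nat)) : QB :=
  \prod_(p <- kn)
    \sum_(s < (p.1 - p.2).+1) 'C(p.1 - p.2, s)%:R *: b (p.1 - s).

(* pi and pi_z have the same formula.  On their domains 0 <= n_i <= k_i. *)
Definition pi_sym (u : sym) : QB := Fword [seq (e.1, `|qexp e|%N) | e <- u].
Definition pi : {malg rat[sym]} -> QB := linext pi_sym.
Definition pi_z : {malg rat[sym]} -> QB := linext pi_sym.

Definition phi_pi (u : {malg rat[sym]}) : {malg rat[(word * word)%type]} :=
  tensmap pi pi_z (phi u).

Definition in_G (u : sym) : bool :=
  in_F_ 0 u && ((u == [::]) || ((last entry0 u).2 != (1, 0))).

Definition QG : {pred {malg rat[sym]}} := fun x => all in_G (msupp x).

Definition eval_z1 : {malg rat[sym]} -> {malg rat[sym]} :=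
  linext (fun u : sym => << [seq (e.1, (0, qexp e)) : entry | e <- u] >>).

(* The symmetric algebra of QB0 is the polynomial algebra on the basis of QB0
   (admissible words); its product is the ring product. *)
Definition admword := {w : word | admissible w}.
Definition SymQB0 := {malg rat[{cmonom admword}]}.

Definition inS_word (w : word) : SymQB0 :=
  if insub w is Some a then << ucm (a : admword) >> else 0.

(* The embedding of QB0 in degree one; only meaningful on QB0. *)
Definition inS : QB -> SymQB0 := linext inS_word.

Definition m_odot : {malg rat[(word * word)%type]} -> SymQB0 :=
  linext (fun p => inS << p.1 >> * inS << p.2 >>).

Definition in_ideal (R : comNzRingType) (gen : R -> Prop) (x : R) : Prop :=
  exists s : seq (R * R),
    (forall p, p \in s -> gen p.2) /\ x = \sum_(p <- s) p.1 * p.2.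

Inductive CF_gen : SymQB0 -> Prop :=
  | CF_unit : CF_gen (inS 1 - 1)
  | CF_confl (u : {malg rat[sym]}) : u \in QG ->
      CF_gen (m_odot (tensmap id reg (phi_pi u)) - inS (pi (eval_z1 u))).

Definition I_CF : SymQB0 -> Prop := in_ideal CF_gen.

Lemma qpow_inj (R : numFieldType) (q : R) :
  0 < `|q| -> `|q| < 1 -> injective (fun m : int => q ^ m).
Proof.
rewrite normr_gt0 => q0 q1 m n /= eq_q.
have key (k : nat) : q ^+ k = 1 -> k = 0%N.
  case: k => // k /(congr1 Num.norm); rewrite normrX normr1 => /eqP.
  by rewrite lt_eqF // exprn_ilt1.
have : q ^ (m - n) = 1 by rewrite expfzDr // eq_q -expfzDr // subrr expr0z.
suff : forall d : int, q ^ d = 1 -> d = 0 by move=> /[apply] /subr0_eq.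
move=> [k|k]; first by rewrite -exprnP => /key ->.
by rewrite NegzE -exprnN => /eqP; rewrite invr_eq1 => /eqP/key.
Qed.

Section Support.
Variables (K : choiceType) (P : pred K).

Definition supp_in (x : {malg rat[K]}) := forall k, x@_k != 0 -> P k.

Lemma supp_in0 : supp_in 0.
Proof. by move=> k; rewrite mcoeff0 eqxx. Qed.

Lemma supp_inD x y : supp_in x -> supp_in y -> supp_in (x + y).
Proof.
move=> hx hy k; rewrite mcoeffD; have [->|/hx //] := eqVneq x@_k 0.
by rewrite add0r => /hy.
Qed.

Lemma supp_inN x : supp_in x -> supp_in (- x).
Proof. by move=> hx k; rewrite mcoeffN oppr_eq0; apply: hx. Qed.

Lemma supp_inZ c x : supp_in x -> supp_in (c *: x).
Proof. by move=> hx k; rewrite mcoeffZ mulf_eq0 negb_or => /andP[_ /hx]. Qed.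

Lemma supp_inU c k : P k -> supp_in << c *g k >>.
Proof.
by move=> Pk l; rewrite mcoeffU; have [<-|_] := eqVneq k l; rewrite ?eqxx.
Qed.

Lemma supp_in_sum (I : eqType) (r : seq I) (F : I -> {malg rat[K]}) :
  (forall i, i \in r -> supp_in (F i)) -> supp_in (\sum_(i <- r) F i).
Proof.
move=> h; rewrite big_seq; apply: (big_ind supp_in) => //.
  exact: supp_in0.
exact: supp_inD.
Qed.

End Support.

Lemma QB0P (x : QB) : reflect (supp_in admissible x) (x \in QB0).
Proof.
apply: (iffP allP) => h k; first by rewrite mcoeff_neq0 => /h.
by rewrite -mcoeff_neq0 => /h.
Qed.

Lemma supp_in_tens (K L : choiceType) (P : pred K) (x : {malg rat[K]})
    (y : {malg rat[L]}) :
  supp_in P x -> supp_in (fun p : K * L => P p.1) (tens x y).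
Proof.
move=> hx; apply: supp_in_sum => k; rewrite -mcoeff_neq0 => /hx Pk.
by apply: supp_in_sum => l _; apply: supp_inU.
Qed.

Lemma supp_in_bM (P : pred word) (i : nat) (x : QB) :
  supp_in (fun w => P (mmul (fmu i) w)) x -> supp_in P (b i * x).
Proof.
move=> hx; rewrite malgM_def fgmulUg; apply: supp_in_sum => w.
by rewrite -mcoeff_neq0 => /hx; apply: supp_inU.
Qed.

Lemma supp_in_linext (K L : choiceType) (P : pred K) (Q : pred L)
    (f : K -> {malg rat[L]}) (x : {malg rat[K]}) :
  supp_in P x -> (forall k, P k -> supp_in Q (f k)) -> supp_in Q (linext f x).
Proof.
move=> hx hf; apply: supp_in_sum => k; rewrite -mcoeff_neq0 => /hx/hf.
exact: supp_inZ.
Qed.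

Lemma stuffle_word_last d (u v : seq nat) :
  last d u != 0%N -> last d v != 0%N ->
  supp_in (fun w : word => last d w != 0%N) (stuffle_word u v).
Proof.
elim: u d v => [|i u IHu] d v /=; first by case: v => [|j v] *; apply: supp_inU.
elim: v d => [|j v IHv] d /= hu hv; first exact: supp_inU.
have hij : last (i + j)%N u != 0%N /\ last (i + j)%N v != 0%N.
  by case: (u) hu (v) hv => [|? ?] /= hu [|? ?] /= hv; rewrite ?addn_eq0
    ?negb_and ?hu ?hv ?orbT.
apply: supp_inD; [apply: supp_inD|]; apply: supp_in_bM => w.
- by move=> /(IHu i _ hu); rewrite fmM fmU /=; apply.
- by move=> /(IHv j hu hv); rewrite fmM fmU /=.
- by case: hij => h1 h2 /(IHu _ v h1 h2); rewrite fmM fmU /=.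
Qed.

Lemma stuffle_QB0 (x y : QB) : x \in QB0 -> y \in QB0 -> stuffle x y \in QB0.
Proof.
move=> /QB0P hx /QB0P hy; apply/QB0P.
apply: supp_in_linext hx _ => u hu; apply: supp_in_linext hy _ => v hv.
exact: stuffle_word_last.
Qed.

Lemma set_nthE (T : Type) (x0 y : T) (s : seq T) i : (i < size s)%N ->
  set_nth x0 s i y = take i s ++ y :: drop i.+1 s.
Proof. by elim: s i => [|x s IHs] [|i] //= hi; rewrite ?drop0 // IHs. Qed.

Definition idx (u : sym) : seq nat := [seq e.1 | e <- u].
Definition pos (u : sym) : bool := all (fun e => 0 < e)%N (idx u).

Lemma idx_set_nth (u : sym) j e : (j < size u)%N ->
  idx (set_nth entry0 u j e) = set_nth 0%N (idx u) j e.1.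
Proof. by elim: u j => [|f u IHu] [|j] //= hj; rewrite IHu. Qed.

Lemma idx_mul_arg (u : sym) j x : (j < size u)%N -> idx (mul_arg u j x) = idx u.
Proof. by elim: u j => [|f u IHu] [|j] //= hj; rewrite -[in RHS](IHu j). Qed.

Definition lower (u w : sym) : bool := pos w && ((weight w).+1 == weight u).

Lemma lower_del (u : sym) j w :
  (j < size u)%N -> (ent u j).1 = 1%N -> pos u -> idx w = idx u ->
  lower u (del w j).
Proof.
move=> hj ej; rewrite /lower /pos /weight -!/(idx _) => hu hw.
have {hw} -> : idx (del w j) = take j (idx u) ++ drop j.+1 (idx u).
  by rewrite /idx map_cat map_take map_drop -/(idx w) hw.
have hd : idx u = take j (idx u) ++ 1%N :: drop j.+1 (idx u).
  rewrite -{1}(cat_take_drop j (idx u)) (drop_nth 0%N) ?size_map //.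
  by rewrite (nth_map entry0) // -/(ent u j) ej.
have -> : sumn (idx u) = (sumn (take j (idx u) ++ drop j.+1 (idx u))).+1.
  by rewrite {1}hd !sumn_cat /= add1n addnS.
by move: hu; rewrite {1}hd eqxx andbT !all_cat.
Qed.

Lemma D_up_supp (u : sym) j : (j < size u)%N -> pos u ->
  supp_in (fun p => lower u p.1) (D_up u j).
Proof.
move=> hj hu; have k0 : (0 < (ent u j).1)%N.
  by move/allP: hu; apply; apply/map_f/mem_nth.
rewrite /D_up; case: ltnP => hk.
  apply/supp_in_tens/supp_inU; rewrite /lower /pos /weight -!/(idx _).
  rewrite /set_index idx_set_nth //= set_nthE ?size_map //.
  have hd : idx u = take j (idx u) ++ (ent u j).1 :: drop j.+1 (idx u).
    rewrite -{1}(cat_take_drop j (idx u)) (drop_nth 0%N) ?size_map //.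
    by rewrite (nth_map entry0).
  have hw : sumn (idx u)
      = (sumn (take j (idx u) ++ (ent u j).1.-1 :: drop j.+1 (idx u))).+1.
    by rewrite {1}hd !sumn_cat /= -{1}(prednK k0) addSn addnS.
  move: hu; rewrite /pos {1}hd hw eqxx andbT !all_cat /= => /and3P[-> _ ->].
  by rewrite -ltnS prednK ?hk.
have k1 : (ent u j).1 = 1%N by apply/eqP; rewrite eqn_leq hk.
have hA : supp_in (lower u) (symA u j).
  case: j hj k1 {k0 hk} => [|j] hj k1 /=; last first.
    by apply/supp_inU/lower_del => //; rewrite idx_mul_arg // ltnW.
  have -> : behead u = del u 0 by rewrite /del take0 drop1.
  exact/supp_inU/lower_del.
have hB : supp_in (lower u) (symB u j).
  rewrite /symB; case: ltnP => hj'; last exact: supp_in0.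
  by apply/supp_inU/lower_del => //; rewrite idx_mul_arg.
case: ifP => _; apply: supp_inD; rewrite ?mulrN; try apply: supp_inN;
  exact: supp_in_tens.
Qed.

Lemma D_supp (u v : sym) : idx u = idx v -> u != v -> pos u ->
  supp_in (fun p => lower u p.1) (D u v).
Proof.
move=> huv nuv hu; have suv : size u = size v.
  by rewrite -(size_map fst u) -/(idx u) huv size_map.
have hj : (diff_pos u v < size u)%N.
  rewrite /diff_pos -[X in (_ < X)%N](@size1_zip _ _ u v) ?suv // -has_find.
  elim: u v nuv suv {huv hu} => [|e u IHu] [|f v] //= + [suv].
  by rewrite eqseq_cons negb_and => /orP[->|/IHu->] //; rewrite orbT.
have lE w : lower v w = lower u w by rewrite /lower /weight -!/(idx _) huv.
rewrite /D; case: ifP => _; first exact: D_up_supp.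
apply: supp_inN => p hp; rewrite -lE; apply: (@D_up_supp v) hp.
  by rewrite -suv.
by rewrite /pos -huv.
Qed.

Lemma ent_shift_z (u : sym) i j : zexp (ent (shift_z u i) j) = zexp (ent u j).
Proof.
rewrite /shift_z /mul_arg /ent nth_set_nth /=; case: eqP => [->|] //.
by rewrite /zexp /= addr0.
Qed.

Lemma shift_path ks (s : seq nat) (u : sym) : idx u = ks ->
  all (fun i => (i < size u)%N && (zexp (ent u i) != 0)) s ->
  path (fun v w => [&& idx v == ks, idx w == ks & v != w])
    u (scanl shift_z u s).
Proof.
move=> <-; have: idx u == idx u by []; move: {2 3 4}(idx u) => k.
elim: s u => //= i s IHs u hu /andP[/andP[hi hz] hs].
have hik : idx (shift_z u i) == k by rewrite /shift_z idx_mul_arg.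
rewrite hu hik /= IHs // ?andbT.
  apply/eqP => /(congr1 (fun w => qexp (ent w i))).
  rewrite /shift_z /mul_arg /ent nth_set_nth /= eqxx /qexp /= -/(ent u i).
  by rewrite -[LHS]addr0 => /addrI /esym/eqP; rewrite (negPf hz).
rewrite -(size_map fst (shift_z u i)) -/(idx _) (eqP hik) -(eqP hu) size_map.
by apply: sub_all hs => j; rewrite ent_shift_z.
Qed.

Lemma partial_supp (u : sym) : pos u ->
  supp_in (fun p => lower u p.1) (partial u).
Proof.
move=> hu.
have hs : all (fun i => (i < size u)%N && (zexp (ent u i) != 0)) (std_order u).
  by apply/allP => j; rewrite mem_sort mem_filter mem_iota add0n andbC.
have /(pathP [::]) hR := shift_path erefl hs.
apply: supp_in_sum => i _.
have /and3P[/eqP h1 /eqP h2 h3] := hR i (ltn_ord i).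
rewrite -/(Std u) in h1 h3.
have hv : pos (nth [::] (Std u) i) by rewrite /pos h1.
move=> p /(D_supp (etrans h1 (esym h2)) h3 hv).
by rewrite /lower {2}/weight -/(idx _) h1.
Qed.

Lemma eq_linext (K : choiceType) (V : lmodType rat) (P : pred K)
    (f g : K -> V) (x : {malg rat[K]}) :
  supp_in P x -> (forall k, P k -> f k = g k) -> linext f x = linext g x.
Proof.
move=> hx hfg; apply: eq_big_seq => k; rewrite -mcoeff_neq0 => /hx Pk.
by rewrite hfg.
Qed.

Lemma phiE (u : sym) : pos u ->
  phi_sym u = applyS phi_sym (partial u) + Const u.
Proof.
move=> hu; rewrite {1}/phi_sym; case wu : (weight u) => [|n] /=.
  have -> : u = [::].
    case: u hu wu => // e u; rewrite /pos /weight /= => /andP[he _] /eqP.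
    by rewrite addn_eq0 eqn0Ngt he.
  rewrite /partial /= big_ord0 /applyS /linext msupp0 big_seq_fset0 add0r.
  by [].
suff -> : applyS (phi_rec n) (partial u) = applyS phi_sym (partial u) by [].
apply: (eq_linext (partial_supp hu)) => p /andP[_ /eqP].
by rewrite wu => /succn_inj ep; rewrite /phi_sym ep.
Qed.

(* Main.v *)
Require Import Defs.
From HB Require Import structures.
From mathcomp Require Import all_boot all_order all_algebra.
From mathcomp Require Import finmap zify.
From mathcomp.multinomials Require Import monalg.
From Stdlib Require Import ClassicalEpsilon.

Set Implicit Arguments.
Unset Strict Implicit.
Unset Printing Implicit Defensive.

Import Order.TTheory GRing.Theory Num.Theory.
Local Open Scope ring_scope.

(* Restores the map pi against the quotient projection of the same name. *)
Local Notation pi := Defs.pi.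

(** The symbols stand for the series
      L_{k_1, ..., k_d}(x_1, ..., x_d)
        = sum_{0 < m_1 < ... < m_d} prod_i x_i^{m_i} / (1 - q^{m_i})^{k_i},
    and products of such series are given by a stuffle product of symbols, in
    which both the indices and the arguments of two merged entries are
    combined.  The theorem comes from applying the confluence relation to the
    stuffle product of a symbol U of C with the symbol V(z) obtained from a
    second symbol V of C by multiplying its last argument by z.

    The key identity is phi(U * V(z)) = U (x) V(z) (lemma [phi_stuffle_sum]).
    Every word of U * V(z) has a single entry depending on z, so its standard
    path has one step.  If the last index of V is at least two, the partial
    derivative lowers it, and it commutes with the stuffle product
    ([partial_sum_index]).  If the last index is one, all the terms of the
    derivative telescope except those in which the last argument of V(z) is
    absorbed by the entry preceding it in V ([partial_sum_one],
    [partial_sum_merge]).  In both cases the map S restores V(z), and phi is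
    determined by induction on the length of V and on its last index; the
    constant term U (x) 1 arises when V is exhausted.

    The remaining points are the following.
    - The map pi turns the stuffle product of symbols into that of words
      ([pi_sym_qsh]): with the letter b_i seen as X^i, an entry (k, q^n) is
      sent to X^n (1 + X)^{k - n}, and merging two entries multiplies the
      polynomials.
    - If the last argument of V is a positive power of q, then pi_z(V(z)) has
      no word ending with b_0, hence is fixed by reg ([reg_QB0]), and U * V(z)
      lies in Q G ([qsh_in_G]).  The confluence relation of U * V(z) is then
      pi(U) . pi(V) - pi(U) * pi(V), where . is the product of the symmetric
      algebra ([confluence_stuffle]).
    - The elements pi(U) span the admissible words ([pi_surj]): the letter b_i
      with i > 0 is the image of the entry (i, q^i), and b_0 is the difference
      of the images of (1, 1) and (1, q).  Bilinearity concludes. *)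

(** * Linear extension *)

Section LinearExtension.
Variables (K : choiceType) (V : lmodType rat).
Implicit Types (f g : K -> V) (x : {malg rat[K]}).

Lemma linextEw f x (d : {fset K}) : (msupp x `<=` d)%fset ->
  linext f x = \sum_(k <- d) x@_k *: f k.
Proof.
move=> sxd; rewrite /linext [RHS](bigID (fun k => k \in msupp x)) /=.
rewrite [X in _ + X]big1 ?addr0; last first.
  by move=> k; rewrite -mcoeff_eq0 => /eqP ->; rewrite scale0r.
rewrite -[RHS]big_filter; apply/perm_big/uniq_perm.
- exact: fset_uniq.
- by rewrite filter_uniq // fset_uniq.
- move=> k; rewrite mem_filter andbC.
  by case: (boolP (k \in d)) => //; apply: contraNF; move/fsubsetP: sxd; apply.
Qed.

Lemma linext_is_linear f : linear (linext f).
Proof.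
move=> c x y; pose d := (msupp x `|` msupp y)%fset.
have sx : (msupp x `<=` d)%fset by apply: fsubsetUl.
have sy : (msupp y `<=` d)%fset by apply: fsubsetUr.
have sxy : (msupp (c *: x + y) `<=` d)%fset.
  apply: (fsubset_trans (msuppD_le _ _)); rewrite fsubUset sy andbT.
  exact: fsubset_trans (msuppZ_le _ _) sx.
rewrite (linextEw f sx) (linextEw f sy) (linextEw f sxy) scaler_sumr -big_split.
by apply: eq_bigr => k _; rewrite mcoeffD mcoeffZ scalerDl scalerA.
Qed.

HB.instance Definition _ f :=
  GRing.isLinear.Build rat {malg rat[K]} V _ (linext f) (linext_is_linear f).

Lemma linextU f k : linext f << k >> = f k.
Proof. by rewrite /linext msuppU oner_eq0 big_seq_fset1 mcoeffUU scale1r. Qed.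

Lemma malgUZ (c : rat) k : << c *g k >> = c *: << k >> :> {malg rat[K]}.
Proof. by apply/malgP => l; rewrite mcoeffZ !mcoeffU mulrnAr mulr1. Qed.

Lemma malg_sum x : x = \sum_(k <- msupp x) x@_k *: << k >>.
Proof.
by rewrite {1}[x]monalgE; apply: eq_bigr => k _; apply: malgUZ.
Qed.

Lemma linextDf f g x : linext (fun k => f k + g k) x = linext f x + linext g x.
Proof. by rewrite -big_split; apply: eq_bigr => k _; rewrite scalerDr. Qed.

Lemma linextZf c f x : linext (fun k => c *: f k) x = c *: linext f x.
Proof.
by rewrite scaler_sumr; apply: eq_bigr => k _; rewrite !scalerA mulrC.
Qed.

End LinearExtension.

(** Linearity as a proposition on bare functions, which is stable under the
    composition of functions without any bundling. *)
Definition lin (U V : lmodType rat) (f : U -> V) : Prop :=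
  forall c x y, f (c *: x + y) = c *: f x + f y.

Section Lin.
Variables (U V W : lmodType rat).

Lemma lin_id : lin (fun x : V => x).
Proof. by []. Qed.

Lemma lin_comp (f : V -> W) (g : U -> V) :
  lin f -> lin g -> lin (fun x => f (g x)).
Proof. by move=> lf lg c x y; rewrite lg lf. Qed.

Lemma lin_add (f g : U -> V) : lin f -> lin g -> lin (fun x => f x + g x).
Proof. by move=> lf lg c x y; rewrite lf lg scalerDr addrACA. Qed.

Lemma lin0 (f : U -> V) : lin f -> f 0 = 0.
Proof.
by move=> lf; have := lf (-1) 0 0; rewrite scaler0 addr0 scaleN1r addNr.
Qed.

Lemma lin_sum (f : U -> V) : lin f ->
  forall (I : Type) (r : seq I) (c : I -> rat) (F : I -> U),
  f (\sum_(i <- r) c i *: F i) = \sum_(i <- r) c i *: f (F i).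
Proof.
move=> lf I r c F; elim: r => [|i r IHr]; last by rewrite !big_cons lf IHr.
by rewrite !big_nil lin0.
Qed.

End Lin.

(** The monoid algebra on words is noncommutative, so that the compatibility of
    scaling with the right factor of a product is not automatic. *)
Lemma QB_scalerAr (c : rat) (x y : QB) : c *: (x * y) = x * (c *: y).
Proof.
apply/malgP => k.
rewrite [LHS]mcoeffZ [X in c * X]mcoeffMl.
rewrite (mcoeffMlw k (fsubset_refl (msupp x)) (msuppZ_le c y)) mulr_sumr.
apply: eq_bigr => k1 _; rewrite mulr_sumr; apply: eq_bigr => k2 _.
by rewrite mcoeffZ mulrnAr mulrCA.
Qed.

Lemma lin_mull (U : lmodType rat) (f : U -> QB) (a : QB) :
  lin f -> lin (fun x => a * f x).
Proof. by move=> lf c x y; rewrite lf mulrDr QB_scalerAr. Qed.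

Lemma lin_mulr (U : lmodType rat) (f : U -> QB) (a : QB) :
  lin f -> lin (fun x => f x * a).
Proof. by move=> lf c x y; rewrite lf mulrDl scalerAl. Qed.

Lemma lin_mulpl (U : lmodType rat) (f : U -> {poly rat}) a :
  lin f -> lin (fun x => a * f x).
Proof. by move=> lf c x y; rewrite lf mulrDr scalerAr. Qed.

Lemma lin_mulpr (U : lmodType rat) (f : U -> {poly rat}) a :
  lin f -> lin (fun x => f x * a).
Proof. by move=> lf c x y; rewrite lf mulrDl scalerAl. Qed.

Lemma lin_linext (K : choiceType) (V : lmodType rat) (f : K -> V) :
  lin (linext f).
Proof. by move=> c x y; rewrite linearP. Qed.

Lemma lin_ext_supp (K : choiceType) (V : lmodType rat) (P : pred K)
    (f g : {malg rat[K]} -> V) : lin f -> lin g ->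
  (forall k, P k -> f << k >> = g << k >>) ->
  forall x, supp_in P x -> f x = g x.
Proof.
move=> lf lg fg x Px; rewrite [x]malg_sum !lin_sum //.
by apply: eq_big_seq => k; rewrite -mcoeff_neq0 => /Px/fg ->.
Qed.

Lemma lin_ext (K : choiceType) (V : lmodType rat)
    (f g : {malg rat[K]} -> V) : lin f -> lin g ->
  (forall k, f << k >> = g << k >>) -> forall x, f x = g x.
Proof. by move=> lf lg fg x; apply: (@lin_ext_supp _ _ xpredT). Qed.

Lemma lin_ext_poly (V : lmodType rat) (f g : {poly rat} -> V) :
  lin f -> lin g -> (forall i, f 'X^i = g 'X^i) -> forall p, f p = g p.
Proof.
move=> lf lg fg p; rewrite -[p]coefK poly_def !lin_sum //.
by apply: eq_bigr => i _; rewrite fg.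
Qed.

(** * Words and their stuffle product *)

(** The word with letters b_i, for i ranging over the sequence s. *)
Definition wd (s : seq nat) : QB := << FMonom s >>.

Lemma lin_ext_wd_supp (P : pred (seq nat)) (V : lmodType rat) (f g : QB -> V) :
  lin f -> lin g -> (forall s, P s -> f (wd s) = g (wd s)) ->
  forall x, supp_in (fun w : word => P w) x -> f x = g x.
Proof.
move=> lf lg fg; apply: (lin_ext_supp lf lg) => w Pw.
by have := fg _ Pw; rewrite /wd fmK.
Qed.

Lemma lin_ext_wd (V : lmodType rat) (f g : QB -> V) : lin f -> lin g ->
  (forall s, f (wd s) = g (wd s)) -> forall x, f x = g x.
Proof. by move=> lf lg fg x; apply: (@lin_ext_wd_supp xpredT). Qed.

Lemma wd_mul s t : wd s * wd t = wd (s ++ t).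
Proof.
rewrite /wd malgM_def fgmulUU mulr1; congr (<< _ >>); apply/eqP.
by rewrite fmP fmM.
Qed.

Lemma wd1 : wd [::] = 1.
Proof. by congr << _ >>; apply/eqP; rewrite fmP fm1. Qed.

Lemma bE i : b i = wd [:: i].
Proof. by congr << _ >>; apply/eqP; rewrite fmP fmU. Qed.

Lemma b_wd i s : b i * wd s = wd (i :: s).
Proof. by rewrite bE wd_mul. Qed.

Lemma wd_b i s : wd s * b i = wd (rcons s i).
Proof. by rewrite bE wd_mul cats1. Qed.

Lemma stuffle_wd s t : stuffle (wd s) (wd t) = stuffle_word s t.
Proof. by rewrite /stuffle !linextU. Qed.

Lemma lin_stufflel (U : lmodType rat) (f : U -> QB) y :
  lin f -> lin (fun x => stuffle (f x) y).
Proof. by move=> lf c x x'; rewrite lf /stuffle linearP. Qed.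

Lemma lin_stuffle_l y : lin (stuffle^~ y).
Proof. by move=> c x x'; rewrite /stuffle linearP. Qed.

Lemma lin_stuffle x : lin (stuffle x).
Proof.
move=> c y z; rewrite /stuffle -linextZf -linextDf.
by apply: eq_bigr => u _; rewrite linearP.
Qed.

Lemma lin_stuffler (U : lmodType rat) (f : U -> QB) x :
  lin f -> lin (fun y => stuffle x (f y)).
Proof.
by move=> lf c y z; rewrite lf lin_stuffle.
Qed.

Lemma stuffle_word0s s : stuffle_word [::] s = wd s.
Proof. by case: s. Qed.

Lemma stuffle_words0 s : stuffle_word s [::] = wd s.
Proof. by case: s. Qed.

Lemma stuffle_word_cons i j s t : stuffle_word (i :: s) (j :: t) =
  b i * stuffle_word s (j :: t) + b j * stuffle_word (i :: s) t
  + b (i + j)%N * stuffle_word s t.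
Proof. by []. Qed.

(** * Letters as polynomials *)

(** The letter b_i stands for X^i, so that b_{i + j} stands for a product; a
    polynomial is a linear combination of letters. *)
Definition letter (p : {poly rat}) : QB := \sum_(i < size p) p`_i *: b i.

Lemma letterEw (p : {poly rat}) n : (size p <= n)%N ->
  letter p = \sum_(i < n) p`_i *: b i.
Proof.
move=> pn; rewrite /letter (big_ord_widen _ (fun i => p`_i *: b i) pn).
rewrite big_mkcond; apply: eq_bigr => i _; case: ltnP => // /(nth_default 0) ->.
by rewrite scale0r.
Qed.

Lemma lin_letter : lin letter.
Proof.
move=> c p q; pose n := maxn (size (p : {poly rat})) (size (q : {poly rat})).
have h : (size (c *: p + q)%R <= n)%N.
  apply: leq_trans (size_polyD _ _) _.
  by rewrite geq_max leq_maxr (leq_trans (size_scale_leq _ _)) ?leq_maxl.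
rewrite (letterEw h) (@letterEw p n) ?leq_maxl // (@letterEw q n) ?leq_maxr //.
rewrite scaler_sumr -big_split; apply: eq_bigr => i _.
by rewrite coefD coefZ scalerDl scalerA.
Qed.

Lemma letterXn i : letter 'X^i = b i.
Proof.
rewrite /letter size_polyXn (bigD1 ord_max) //= coefXn eqxx scale1r.
rewrite big1 ?addr0 // => j ne.
by rewrite coefXn (_ : (_ == _) = false) ?scale0r //; apply/negbTE.
Qed.

Lemma lin_letterf (U : lmodType rat) (f : U -> {poly rat}) :
  lin f -> lin (fun x => letter (f x)).
Proof. by move=> lf c x y; rewrite lf lin_letter. Qed.

(* Linearity of an expression built from products, stuffle products and
   letters; by_words and by_letters use it to reduce an identity between linear
   functions to words, respectively to powers of X. *)
Ltac lin_tac := cbv beta; match goal with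
  | |- lin (fun x => x) => exact: lin_id
  | |- lin (fun x => @?f x + @?g x) => apply: lin_add; lin_tac
  | |- lin ( *%R ?a) =>
      exact: (lin_mull a (@lin_id _)) || exact: (lin_mulpl a (@lin_id _))
  | |- lin (stuffle ?x) => exact: lin_stuffle
  | |- lin letter => exact: lin_letter
  | |- lin (fun x => ?a * @?f x) =>
      (apply: lin_mull || apply: lin_mulpl); lin_tac
  | |- lin (fun x => @?f x * ?a) =>
      (apply: lin_mulr || apply: lin_mulpr); lin_tac
  | |- lin (fun x => stuffle (@?f x) ?y) => apply: lin_stufflel; lin_tac
  | |- lin (fun x => stuffle ?y (@?f x)) => apply: lin_stuffler; lin_tac
  | |- lin (fun x => letter (@?f x)) => apply: lin_letterf; lin_tac
  | _ => try done
  end.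

Ltac by_words := match goal with
  | |- forall x, @?f x = @?g x =>
      apply: (@lin_ext_wd _ f g); [lin_tac|lin_tac|cbv beta]
  end.

Ltac by_letters := match goal with
  | |- forall p, @?f p = @?g p =>
      apply: (@lin_ext_poly _ f g); [lin_tac|lin_tac|cbv beta]
  end.

Lemma stuffle1x y : stuffle 1 y = y.
Proof.
move: y; by_words.
by move=> s; rewrite -wd1 stuffle_wd stuffle_word0s.
Qed.

Lemma stufflex1 x : stuffle x 1 = x.
Proof.
move: x; by_words.
by move=> s; rewrite -wd1 stuffle_wd stuffle_words0.
Qed.

(** The recursion of the stuffle product when the first letters are replaced by
    linear combinations of letters. *)
Lemma stuffle_letter p q x y :
  stuffle (letter p * x) (letter q * y) =
    letter p * stuffle x (letter q * y) + letter q * stuffle (letter p * x) y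
    + letter (p * q) * stuffle x y.
Proof.
move: x; by_words => u; move: y; by_words => v.
move: p; by_letters => i; move: q; by_letters => j.
rewrite -exprD !letterXn !b_wd !stuffle_wd stuffle_word_cons; reflexivity.
Qed.

(** * Regularization *)

(** The recursion of the stuffle product on first letters implies the mirror
    recursion on last letters; only the ring structure matters, so the letters
    a, the words W and the product sw are abstract. *)
Section RconsRecursion.
Variables (A : pzRingType) (a : nat -> A) (W : seq nat -> A).
Variable sw : seq nat -> seq nat -> A.
Hypothesis aW : forall i s, a i * W s = W (i :: s).
Hypothesis Wa : forall i s, W s * a i = W (rcons s i).
Hypothesis sw0s : forall s, sw [::] s = W s.
Hypothesis sws0 : forall s, sw s [::] = W s.
Hypothesis sw_cons : forall i j s t, sw (i :: s) (j :: t) =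
  a i * sw s (j :: t) + a j * sw (i :: s) t + a (i + j)%N * sw s t.

Lemma rcons_rec i j s t : sw (rcons s i) (rcons t j) =
  sw s (rcons t j) * a i + sw (rcons s i) t * a j + sw s t * a (i + j)%N.
Proof.
elim: s t => [|k s IHs] t.
  rewrite !sw0s /=; elim: t => [|l t IHt].
    rewrite /= sw_cons !sw0s !sws0 !aW !Wa /=.
    by rewrite [W [:: j; i] + _]addrC.
  rewrite /= !sw_cons !sw0s {}IHt !mulrDr !mulrDl.
  by rewrite !(mulrA, aW, Wa) /= ?addrA [LHS](ACl (2*1*3*5*4)).
elim: t => [|l t IHt].
  rewrite !sws0 /= sw_cons !sws0.
  have := IHs [::]; rewrite !sws0 /= => ->.
  rewrite !mulrDr ?(mulrA, aW, Wa) /=.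
  rewrite sw_cons !mulrDl !sws0 ?(mulrA, aW, Wa) /=.
  by rewrite ?addrA [LHS](ACl (1*4*5*2*3)).
have H1 := IHs (l :: t); have H2 := IHs t; rewrite !rcons_cons in H1 IHt *.
rewrite !sw_cons H1 H2 IHt !mulrDr !mulrDl !mulrA ?addrA.
by rewrite [LHS](ACl (1*4*7*2*5*8*3*6*9)).
Qed.
End RconsRecursion.

Lemma stuffle_word_rcons i j s t :
  stuffle_word (rcons s i) (rcons t j) =
    stuffle_word s (rcons t j) * b i + stuffle_word (rcons s i) t * b j
    + stuffle_word s t * b (i + j)%N.
Proof.
exact: (rcons_rec b_wd wd_b stuffle_word0s stuffle_words0 stuffle_word_cons).
Qed.

(** Removal of a trailing b_0; words that do not end with b_0 are sent to 0.
    The map id + delta is multiplicative for the stuffle product and fixes QB0;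
    the two special cases needed are delta_stuffle_adm and delta_stuffle_b0. *)
Definition delta : QB -> QB := linext (fun w : word =>
  if (w : seq nat) is i :: s then
    (if last i s == 0%N then wd (belast i s) else 0)
  else 0).

Lemma lin_delta : lin delta.
Proof. exact: lin_linext. Qed.

Lemma delta_wd0 : delta (wd [::]) = 0.
Proof. by rewrite /delta linextU. Qed.

Lemma delta_wd_rcons s i :
  delta (wd (rcons s i)) = if i == 0%N then wd s else 0.
Proof.
rewrite /delta linextU /=; case: s => [|j s] //=.
by rewrite last_rcons belast_rcons.
Qed.

Lemma deltaM x i : delta (x * b i) = if i == 0%N then x else 0.
Proof.
case: eqP => [->|/eqP i0].
  move: x; apply: lin_ext_wd.
  - by move=> c x y; rewrite mulrDl -scalerAl lin_delta.
  - by [].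
  by move=> s; rewrite wd_b delta_wd_rcons.
move: x; apply: lin_ext_wd.
- by move=> c x y; rewrite mulrDl -scalerAl lin_delta.
- by move=> c x y; rewrite scaler0 addr0.
by move=> s; rewrite wd_b delta_wd_rcons (negPf i0).
Qed.

Lemma deltaD x y : delta (x + y) = delta x + delta y.
Proof. by rewrite -[x in LHS]scale1r lin_delta scale1r. Qed.

Lemma delta_stuffle_rcons i j s t :
  delta (stuffle_word (rcons s i) (rcons t j)) =
    (if i == 0%N then stuffle_word s (rcons t j) else 0)
    + (if j == 0%N then stuffle_word (rcons s i) t else 0)
    + (if (i + j == 0)%N then stuffle_word s t else 0).
Proof.
rewrite stuffle_word_rcons (deltaD (_ + _)) (deltaD (_ * b i)).
congr (_ + _ + _); exact: deltaM.
Qed.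

Lemma delta_stuffle_wd s t : last 1%N s != 0%N ->
  delta (stuffle_word s t) = stuffle (wd s) (delta (wd t)).
Proof.
case/lastP: s => [|s i] hs; first by rewrite stuffle_word0s wd1 stuffle1x.
rewrite last_rcons in hs; case/lastP: t => [|t j].
  rewrite stuffle_words0 delta_wd_rcons (negPf hs) delta_wd0 lin0 //.
  exact: lin_stuffle.
rewrite delta_stuffle_rcons addn_eq0 (negPf hs) add0r addr0 delta_wd_rcons.
case: eqP => _; first by rewrite stuffle_wd.
by rewrite lin0 //; apply: lin_stuffle.
Qed.

Lemma delta_stuffle_adm x y : x \in QB0 ->
  delta (stuffle x y) = stuffle x (delta y).
Proof.
move=> /QB0P; move: x; apply: (@lin_ext_wd_supp (fun s => last 1%N s != 0%N)).
- by move=> c x x'; rewrite lin_stuffle_l lin_delta.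
- exact: lin_stuffle_l.
move=> s hs; move: y; apply: lin_ext_wd.
- by move=> c x x'; rewrite lin_stuffle lin_delta.
- by move=> c x x'; rewrite lin_delta lin_stuffle.
by move=> t; rewrite stuffle_wd delta_stuffle_wd.
Qed.

Lemma delta_stuffle_b0 y :
  delta (stuffle y (b 0)) = stuffle (delta y) (b 0) + y + delta y.
Proof.
move: y; apply: lin_ext_wd.
- by move=> c x x'; rewrite (lin_stuffle_l _) lin_delta.
- apply: lin_add; last exact: lin_delta.
  by apply: lin_add; [apply: lin_stufflel; apply: lin_delta|apply: lin_id].
case/lastP => [|s j].
  rewrite wd1 stuffle1x -wd1 delta_wd0 (lin0 (lin_stuffle_l _)).
  by rewrite bE (delta_wd_rcons [::]) /= add0r addr0.
rewrite bE stuffle_wd (delta_stuffle_rcons _ _ _ [::]) addn0.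
rewrite !stuffle_words0 delta_wd_rcons /=.
case: eqP => _; first by rewrite stuffle_wd.
by rewrite (lin0 (lin_stuffle_l _)).
Qed.

Lemma delta_QB0 x : x \in QB0 -> delta x = 0.
Proof.
move=> hx; rewrite -(stufflex1 x) delta_stuffle_adm // -wd1 delta_wd0 lin0 //.
exact: lin_stuffle.
Qed.

Local Notation pw := (stuffle_pow (b 0)).

Lemma delta_pow k : delta (pw k) = \sum_(j < k) 'C(k, j)%:R *: pw j.
Proof.
elim: k => [|k IHk]; first by rewrite big_ord0 /= -wd1 delta_wd0.
rewrite /stuffle_pow iterS -/(pw k) delta_stuffle_b0 IHk.
rewrite (lin_sum (lin_stuffle_l _)) /=.
rewrite -addrA [X in _ + X]addrC.
have -> : \sum_(j < k) 'C(k, j)%:R *: pw j + pw k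
       = \sum_(j < k.+1) 'C(k, j)%:R *: pw j.
  rewrite big_ord_recr /= binn scale1r; reflexivity.
rewrite [RHS]big_ord_recl big_ord_recl /= !bin0 addrCA -big_split.
congr (_ + _); apply: eq_bigr => j _.
by rewrite -[LHS]scalerDl -natrD addnC -binS.
Qed.

Lemma iter_delta_lin n : lin (iter n delta).
Proof. by elim: n => [|n IHn] c x y //=; rewrite IHn lin_delta. Qed.

Lemma iter_delta_pow_gt k n : (k < n)%N -> iter n delta (pw k) = 0.
Proof.
elim/ltn_ind: k n => k IHk [|n] // kn; rewrite iterSr delta_pow.
rewrite (lin_sum (@iter_delta_lin n)) big1 // => j _.
by rewrite IHk ?scaler0 // (leq_trans (ltn_ord j)).
Qed.

Lemma iter_delta_pow k : iter k delta (pw k) = k`!%:R *: 1.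
Proof.
elim: k => [|k IHk]; first by rewrite scale1r.
rewrite iterSr delta_pow (lin_sum (@iter_delta_lin k)) big_ord_recr.
rewrite big1 => [|j _]; last first.
  by rewrite iter_delta_pow_gt ?scaler0 /=.
rewrite [LHS]add0r /= IHk scalerA binSn -natrM -factS; reflexivity.
Qed.

Lemma iter_delta_stuffle_adm n x y : x \in QB0 ->
  iter n delta (stuffle x y) = stuffle x (iter n delta y).
Proof.
move=> hx; elim: n => [|n IHn]; first by [].
rewrite !iterS IHn (delta_stuffle_adm _ hx); reflexivity.
Qed.

(** Uniqueness of the regularization of an element of QB0.  If the stuffle
    powers of b_0 occur up to exponent k > 0, then applying delta k times kills
    the terms of lower exponent and turns the last term into k! times its
    coefficient, which must therefore vanish. *)
Lemma is_reg_uniq (u u0 : QB) : u \in QB0 -> is_reg u u0 -> u0 = u.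
Proof.
move=> hu [us [hus eu ->]]; move: hus eu; elim/last_ind: us => [|us a IHus].
  by move=> _ ->; rewrite big_ord0.
rewrite all_rcons size_rcons => /andP[/= ha hus]; rewrite big_ord_recr /=.
rewrite nth_rcons ltnn eqxx.
under eq_bigr => i _ do rewrite nth_rcons ltn_ord.
case: (posnP (size us)) => [/size0nil -> | us0] eu.
  by rewrite eu big_ord0 add0r /= stufflex1.
suff a0 : a = 0.
  rewrite nth_rcons us0; apply: IHus => //.
  by rewrite eu a0 (lin0 (lin_stuffle_l _)) addr0.
have := congr1 (iter (size us) delta) eu.
rewrite -(prednK us0) iterSr delta_QB0 // (lin0 (@iter_delta_lin _)) prednK //.
rewrite -[X in iter _ delta (X + _)]scale1r iter_delta_lin scale1r.
rewrite iter_delta_stuffle_adm // iter_delta_pow.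
have -> : iter (size us) delta
    (\sum_(i < size us) stuffle us`_i (pw i)) = 0.
  under eq_bigr => i _ do rewrite -[stuffle _ _]scale1r.
  rewrite (lin_sum (@iter_delta_lin _)) big1 // => i _.
  rewrite iter_delta_stuffle_adm; last by move/all_nthP: hus; apply.
  by rewrite iter_delta_pow_gt // (lin0 (lin_stuffle _)) scaler0.
rewrite add0r -[_ *: 1]addr0 lin_stuffle stufflex1 (lin0 (lin_stuffle _)) addr0.
move/esym/eqP; rewrite scaler_eq0 pnatr_eq0.
by rewrite (gtn_eqF (fact_gt0 _)) => /eqP.
Qed.

Lemma reg_QB0 (u : QB) : u \in QB0 -> reg u = u.
Proof.
move=> hu; apply: (is_reg_uniq hu); rewrite /reg; apply: epsilon_spec.
exists u, [:: u]; split => //=; first by rewrite hu.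
by rewrite big_ord_recr big_ord0 /= add0r stufflex1.
Qed.

(** * Tensors *)

Section Tensor.
Variables K L : choiceType.
Implicit Types (x : {malg rat[K]}) (y : {malg rat[L]}).

Lemma tensE x y :
  tens x y = linext (fun k => linext (fun l => << (k, l) >>) y) x.
Proof.
apply: eq_bigr => k _; rewrite [in RHS]/linext scaler_sumr.
apply: eq_bigr => l _; rewrite scalerA; exact: malgUZ.
Qed.

Lemma tensUr k y :
  tens (<< k >> : {malg rat[K]}) y = linext (fun l => << (k, l) >>) y.
Proof. by rewrite tensE linextU. Qed.

Lemma tensUU k l : tens (<< k >> : {malg rat[K]}) (<< l >> : {malg rat[L]})
  = (<< (k, l) >> : {malg rat[(K * L)%type]}).
Proof. by rewrite tensUr linextU. Qed.

Lemma tensBr x y y' : tens x (y - y') = tens x y - tens x y'.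
Proof.
rewrite !tensE -[X in _ = _ + X]scaleN1r -linextZf -linextDf.
by apply: eq_bigr => k _; rewrite linearB scaleN1r.
Qed.

Lemma tens0l y : tens (0 : {malg rat[K]}) y = 0.
Proof. by rewrite tensE linear0. Qed.

Lemma tensNr x y : tens x (- y) = - tens x y.
Proof. by rewrite -[- y]add0r tensBr -[0]subr0 tensBr subrr sub0r. Qed.

End Tensor.

(** * The stuffle product of symbols *)

(** Merging two entries: in the product of the series, the general terms
    x^m / (1 - q^m)^k and y^m / (1 - q^m)^l combine into
    (x y)^m / (1 - q^m)^(k + l). *)
Definition adde (a c : entry) : entry := ((a.1 + c.1)%N, a.2 + c.2).

(** The list, with multiplicities, of the symbols of the stuffle (quasi-shuffle)
    product of two symbols. *)
Fixpoint qsh (u : sym) : sym -> seq sym :=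
  fix aux (v : sym) : seq sym :=
    match u, v with
    | [::], _ => [:: v]
    | _, [::] => [:: u]
    | a :: u', c :: v' =>
        [seq a :: w | w <- qsh u' v] ++ [seq c :: w | w <- aux v']
        ++ [seq adde a c :: w | w <- qsh u' v']
    end.

Lemma qsh0s v : qsh [::] v = [:: v]. Proof. by case: v. Qed.
Lemma qshs0 u : qsh u [::] = [:: u]. Proof. by case: u. Qed.

Lemma qsh_cons a c u v : qsh (a :: u) (c :: v) =
  [seq a :: w | w <- qsh u (c :: v)] ++ [seq c :: w | w <- qsh (a :: u) v]
  ++ [seq adde a c :: w | w <- qsh u v].
Proof. by []. Qed.

Arguments qsh : simpl never.

(** The recursion of the stuffle product under a sum; the prefix P makes it
    iterable. *)
Lemma big_qsh_cons (M : nmodType) (f : sym -> M) P a c u v :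
  \sum_(w <- qsh (a :: u) (c :: v)) f (P ++ w) =
    \sum_(w <- qsh u (c :: v)) f (rcons P a ++ w)
    + (\sum_(w <- qsh (a :: u) v) f (rcons P c ++ w)
       + \sum_(w <- qsh u v) f (rcons P (adde a c) ++ w)).
Proof.
rewrite qsh_cons !big_cat !big_map.
by congr (_ + (_ + _)); apply: eq_bigr => w _; rewrite cat_rcons.
Qed.

(** * The differential of a symbol with a single entry depending on z *)

(** No argument depends on z. *)
Definition zfree (u : sym) : bool := all (fun e => zexp e == 0) u.

Lemma ent_mid P e R : ent (P ++ e :: R) (size P) = e.
Proof. by rewrite /ent nth_cat ltnn subnn. Qed.

Lemma set_nth_mid P e f R :
  set_nth entry0 (P ++ e :: R) (size P) f = P ++ f :: R.
Proof. by elim: P => //= a P ->. Qed.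

Lemma mul_arg_mid P e R x :
  mul_arg (P ++ e :: R) (size P) x = P ++ (e.1, e.2 + x) :: R.
Proof. by rewrite /mul_arg set_nth_mid ent_mid. Qed.

Lemma del_mid P e R : del (P ++ e :: R) (size P) = P ++ R.
Proof.
rewrite /del take_size_cat // -cat_rcons -(size_rcons P e).
by rewrite drop_size_cat.
Qed.

Lemma std_order_zfree u : zfree u -> std_order u = [::].
Proof.
move=> hu; rewrite /std_order (@eq_in_filter _ _ pred0) ?filter_pred0 // => i.
rewrite mem_iota /= add0n => hi; apply/negbTE; rewrite negbK.
exact: (allP hu) (mem_nth _ hi).
Qed.

Lemma std_order_mid P e R : zfree P -> zfree R -> zexp e != 0 ->
  std_order (P ++ e :: R) = [:: size P].
Proof.
move=> hP hR he; rewrite /std_order.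
suff -> : [seq i <- iota 0 (size (P ++ e :: R)) |
            zexp (ent (P ++ e :: R) i) != 0] = [:: size P] by [].
rewrite size_cat /= iotaD add0n filter_cat /= ent_mid he.
rewrite (@eq_in_filter _ _ pred0) ?filter_pred0 /=; last first.
  move=> i; rewrite mem_iota add0n /= => hi; apply/negbTE; rewrite negbK.
  by rewrite /ent nth_cat hi; apply: (allP hP) (mem_nth _ hi).
congr (_ :: _); rewrite (@eq_in_filter _ _ pred0) ?filter_pred0 // => i.
rewrite mem_iota => /andP[hi hi']; apply/negbTE; rewrite negbK.
rewrite /ent nth_cat ltnNge (ltnW hi) /= -[(i - _)%N]prednK ?subn_gt0 //=.
apply: (allP hR); apply: mem_nth.
by rewrite -subnS ltn_subLR.
Qed.

Lemma diff_pos_mid P e f R : e != f ->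
  diff_pos (P ++ e :: R) (P ++ f :: R) = size P.
Proof.
move=> hef; rewrite /diff_pos; elim: P => [|a P IHP] /=; first by rewrite hef.
by rewrite eqxx IHP.
Qed.

(** A single entry depends on z, so the standard path has only one step. *)
Lemma partial_mid P e R : zfree P -> zfree R -> zexp e = 1 ->
  partial (P ++ e :: R) = D_up (P ++ e :: R) (size P).
Proof.
move=> hP hR he; rewrite /partial /Std std_order_mid ?he //= big_ord1 /=.
rewrite /shift_z ent_mid he mul_arg_mid /D diff_pos_mid.
  by rewrite mul_arg_mid eqxx.
apply/eqP => /(congr1 qexp); rewrite /qexp /= -[LHS]addr0.
by move=> /addrI /eqP.
Qed.

Lemma partial_zfree u : zfree u -> partial u = 0.
Proof. by move=> hu; rewrite /partial /Std std_order_zfree //= big_ord0. Qed.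

Lemma partial_index P k x R : zfree P -> zfree R -> x.1 = 1 -> (0 < k)%N ->
  partial (P ++ (k.+1, x) :: R) = << (P ++ (k, x) :: R, None) >>.
Proof.
move=> hP hR hx k0; rewrite partial_mid // /D_up ent_mid /= ltnS k0.
by rewrite tensUU /set_index set_nth_mid ent_mid.
Qed.

(** The symbol A of the single-position difference at an entry (1, x) placed
    between P and R: the argument x is absorbed by the last entry of P, or
    dropped if P is empty. *)
Definition absorb (P : sym) (x : arg) (R : sym) : {malg rat[sym]} :=
  symA (P ++ (1%N, x) :: R) (size P).

Lemma absorb_nil x R : absorb [::] x R = << R >>.
Proof. by []. Qed.

Lemma symAS u i :
  symA u i.+1 = << del (mul_arg u i (ent u i.+1).2) i.+1 >>.
Proof. by []. Qed.

Lemma absorb_rcons P c x R :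
  absorb (rcons P c) x R = << P ++ (c.1, c.2 + x) :: R >>.
Proof.
have := ent_mid (rcons P c) (1%N, x) R; rewrite size_rcons => ez.
rewrite /absorb size_rcons symAS ez cat_rcons mul_arg_mid -cat_rcons.
by rewrite -(size_rcons P (c.1, c.2 + x)) del_mid cat_rcons.
Qed.

Lemma symB_nil P x : symB (P ++ [:: (1%N, x)]) (size P) = 0.
Proof. by rewrite /symB size_cat addn1 ltnn. Qed.

Lemma symB_cons P x c R : symB (P ++ (1%N, x) :: c :: R) (size P) =
  << P ++ (c.1, c.2 + x) :: R >>.
Proof.
rewrite /symB size_cat /= !addnS !ltnS leq_addr ent_mid /=.
rewrite -cat_rcons -(size_rcons P (1%N, x)) mul_arg_mid.
by rewrite cat_rcons del_mid.
Qed.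

Lemma pos_cons c u : pos (c :: u) = (0 < c.1)%N && pos u.
Proof. by []. Qed.

Lemma zfree_cons c u : zfree (c :: u) = (zexp c == 0) && zfree u.
Proof. by []. Qed.

(** The telescoping in partial_sum_one: a is the term in which the argument of z
    is absorbed by the first entry of U, on the letter e_{q^{-m}}, a' is the
    same term on the letter e_0, and c is the surviving term. *)
Lemma zmod_cancel (M : zmodType) (a a' c : M) :
  - a + (- c + (a - a') + a') = - c.
Proof. by rewrite -(addrA (- c)) subrK [- c + a]addrC addKr. Qed.

(** The entry depending on z is (1, z q^m). *)
Section IndexOne.
Variable m : int.
Let x : arg := (1, m).
Let e : {malg rat[omega]} := << Some (- m) >>.
Let e0 : {malg rat[omega]} := << None >>.

Lemma partial_one P R : zfree P -> zfree R ->
  partial (P ++ (1%N, x) :: R) =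
   - tens (absorb P x R) e + tens (symB (P ++ (1%N, x) :: R) (size P)) (e - e0).
Proof. by move=> hP hR; rewrite partial_mid // /D_up ent_mid. Qed.

(** Stuffling the single entry (1, z q^m) with U after a fixed prefix P: all the
    terms cancel but the one in which z q^m is absorbed by P. *)
Lemma partial_sum_one P U : zfree P -> zfree U -> pos U ->
  \sum_(w <- qsh U [:: (1%N, x)]) partial (P ++ w) = - tens (absorb P x U) e.
Proof.
elim: U P => [|c U IHU] P hP.
  by rewrite qsh0s big_seq1 partial_one // symB_nil tens0l addr0.
move=> /= /andP[hc hU] /andP[c0 pU].
have hPc : zfree (rcons P c) by rewrite /zfree all_rcons hc.
rewrite (big_qsh_cons partial) qshs0 qshs0 !big_seq1 (IHU _ hPc hU pU).
rewrite absorb_rcons !cat_rcons partial_one //=; last by rewrite hc.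
rewrite symB_cons tensBr /adde /= addn1 partial_index //; last first.
  by rewrite /= (eqP hc : c.2.1 = 0) add0r.
rewrite -tensUU; exact: zmod_cancel.
Qed.

(* A symbol on the letter e_{q^{-m}}, with the sign of the surviving terms. *)
Let nt (w : sym) : {malg rat[(sym * omega)%type]} := - << (w, Some (- m)) >>.

Lemma tens_absorb_rcons P c R :
  - tens (absorb (rcons P c) x R) e = nt (P ++ (c.1, c.2 + x) :: R).
Proof. rewrite absorb_rcons tensUU; reflexivity. Qed.

(** Only the terms in which z q^m is absorbed by the entry y preceding it
    survive. *)
Lemma partial_sum_merge P U V y : zfree P -> zfree U -> pos U ->
    zfree V -> zexp y = 0 ->
  \sum_(w <- qsh U (rcons (rcons V y) (1%N, x))) partial (P ++ w) =
  \sum_(w <- qsh U (rcons V (y.1, y.2 + x))) nt (P ++ w).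
Proof.
move=> hP hU pU hV hy; elim: U P V hP hU pU hV => [|c U IHU] P V hP hU pU hV.
  rewrite !qsh0s !big_seq1 -(cats1 (rcons V y)) catA partial_one //; last first.
    by rewrite /zfree all_cat [all _ P]hP all_rcons hy eqxx.
  rewrite symB_nil tens0l addr0 -rcons_cat tens_absorb_rcons -cats1 catA.
  reflexivity.
have [pcU hcU] := (pU, hU).
move: pU hU; rewrite pos_cons zfree_cons => /andP[c0 pU] /andP[hc hU].
have hPc : zfree (rcons P c) by rewrite /zfree all_rcons hc.
have hPs f : zexp f = 0 -> forall P, zfree P -> zfree (rcons P f).
  by move=> hf Q hQ; rewrite /zfree all_rcons hf eqxx.
have hac f : zexp f = 0 -> zexp (adde c f) = 0.
  by move=> hf; rewrite /zexp /= (eqP hc : c.2.1 = 0) (hf : f.2.1 = 0).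
elim: V P hP hPc hV => [|a V IHV] P hP hPc hV.
  have hPy := hPs _ hy _ hP; have hPcy := hPs _ (hac _ hy) _ hP.
  rewrite (big_qsh_cons partial) (big_qsh_cons nt) !qshs0 !big_seq1.
  rewrite (IHU _ [::] hPc hU pU isT).
  rewrite (partial_sum_one hPy hcU pcU) (partial_sum_one hPcy hU pU).
  rewrite 2!tens_absorb_rcons !cat_rcons /adde /= (addrA c.2).
  reflexivity.
move: (hV); rewrite zfree_cons => /andP[/eqP ha hV'].
have hPa := hPs _ ha _ hP; have hPca := hPs _ (hac _ ha) _ hP.
have hPac := hPs _ (eqP hc) _ hPa.
rewrite /= (big_qsh_cons partial) (big_qsh_cons nt).
rewrite -!rcons_cons (IHU _ (a :: V)) // (IHV _ hPa) // (IHU _ V hPca) //.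
Qed.
End IndexOne.

(** When the entry depending on z has index at least two, the derivative lowers
    this index, and so commutes with the stuffle product. *)
Lemma partial_sum_index P U V k (x : arg) : zfree P -> zfree U -> pos U ->
    zfree V -> x.1 = 1 -> (0 < k)%N ->
  \sum_(w <- qsh U (rcons V (k.+1, x))) partial (P ++ w) =
  \sum_(w <- qsh U (rcons V (k, x))) << (P ++ w, None) >>.
Proof.
move=> hP + + + hx k0; elim: U P V hP => [|c U IHU] P V hP hU pU hV.
  rewrite !qsh0s !big_seq1 -!cats1 !catA partial_index //.
  by rewrite /zfree all_cat [all _ P]hP.
have [pcU hcU] := (pU, hU).
move: pU hU; rewrite pos_cons zfree_cons => /andP[c0 pU] /andP[/eqP hc hU].
have hPs f : zexp f = 0 -> forall P, zfree P -> zfree (rcons P f).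
  by move=> hf Q hQ; rewrite /zfree all_rcons hf eqxx.
pose nt (w : sym) : {malg rat[(sym * omega)%type]} := << (w, None) >>.
have hPc := hPs _ hc _ hP.
elim: V P hP hPc hV => [|a V IHV] P hP hPc hV.
  rewrite (big_qsh_cons partial) (big_qsh_cons nt) !qshs0 !big_seq1.
  rewrite (IHU _ [::] hPc hU pU isT) !cat_rcons partial_index //.
  rewrite /adde /= addnS partial_index //; last 2 first.
  - by rewrite /= (hc : c.2.1 = 0) hx.
  - by rewrite addn_gt0 c0.
move: (hV); rewrite zfree_cons => /andP[/eqP ha hV'].
have hPa := hPs _ ha _ hP.
have hac : zexp (adde c a) = 0.
  by rewrite /zexp /= (hc : c.2.1 = 0) (ha : a.2.1 = 0).
have hPca := hPs _ hac _ hP; have hPac := hPs _ hc _ hPa.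
rewrite /= (big_qsh_cons partial) (big_qsh_cons nt).
rewrite -!rcons_cons (IHU _ (a :: V)) // (IHV _ hPa) // (IHU _ V hPca) //.
Qed.

(** * Words of a stuffle product of symbols *)

(** Induction on a word of the stuffle product. *)
Lemma qsh_ind (Q : sym -> sym -> sym -> Prop) :
  (forall v, Q [::] v v) -> (forall u, Q u [::] u) ->
  (forall a c u v w, Q u (c :: v) w -> Q (a :: u) (c :: v) (a :: w)) ->
  (forall a c u v w, Q (a :: u) v w -> Q (a :: u) (c :: v) (c :: w)) ->
  (forall a c u v w, Q u v w -> Q (a :: u) (c :: v) (adde a c :: w)) ->
  forall u v w, w \in qsh u v -> Q u v w.
Proof.
move=> Q0s Qs0 Ql Qr Qm; elim=> [|a u IHu] v w.
  by rewrite qsh0s inE => /eqP ->.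
elim: v w => [|c v IHv] w; first by rewrite qshs0 inE => /eqP ->.
rewrite qsh_cons !mem_cat => /or3P[] /mapP[w' + ->].
- by move/IHu/Ql.
- by move/IHv/Qr.
- by move/IHu/Qm.
Qed.

Lemma qsh_all (p r s : pred entry) u v w :
  (forall a, p a -> s a) -> (forall c, r c -> s c) ->
  (forall a c, p a -> r c -> s (adde a c)) ->
  all p u -> all r v -> w \in qsh u v -> all s w.
Proof.
move=> ps rs prs pu rv hw; move: hw pu rv.
apply: (qsh_ind (Q := fun u v w => all p u -> all r v -> all s w)).
- by move=> v' _; apply: sub_all.
- by move=> u' + _; apply: sub_all.
- by move=> a c u' v' w' IH /= /andP[/ps-> pu] rv; apply: IH.
- by move=> a c u' v' w' IH /= pu /andP[/rs-> rv]; apply: IH.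
- move=> a c u' v' w' IH /= /andP[pa pu] /andP[rc rv].
  by rewrite prs //=; apply: IH.
Qed.

Lemma qsh_arg_sum u v w : w \in qsh u v ->
  \sum_(e <- w) e.2 = \sum_(e <- u) e.2 + \sum_(e <- v) e.2.
Proof.
apply: (qsh_ind (Q := fun u v w =>
  \sum_(e <- w) e.2 = \sum_(e <- u) e.2 + \sum_(e <- v) e.2)) => {u v w}.
- by move=> v; rewrite big_nil add0r.
- by move=> u; rewrite big_nil addr0.
- by move=> a c u v w IH; rewrite 2!big_cons IH addrA.
- by move=> a c u v w IH; rewrite big_cons IH [X in _ = _ + X]big_cons addrCA.
- by move=> a c u v w; rewrite !big_cons => ->; rewrite addrACA.
Qed.

Lemma arg_sum1 (u : sym) : (\sum_(e <- u) e.2).1 = \sum_(e <- u) zexp e.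
Proof. by rewrite (big_morph fst (id1 := 0) (op1 := +%R)). Qed.

Lemma zfree_arg_sum u : zfree u -> (\sum_(e <- u) e.2).1 = 0.
Proof.
rewrite arg_sum1; elim: u => [|c u IHu]; first by rewrite big_nil.
by rewrite zfree_cons big_cons => /andP[/eqP -> /IHu ->].
Qed.

Lemma posE u : pos u = all (fun e => 0 < e.1)%N u.
Proof. by rewrite /pos /idx all_map. Qed.

Lemma qsh_pos u v w : pos u -> pos v -> w \in qsh u v -> pos w.
Proof.
rewrite !posE; apply: qsh_all => // a c.
by rewrite /= addn_gt0 => ->.
Qed.

Lemma in_C_zfree u : in_C u -> zfree u.
Proof. by case/andP. Qed.

(** The exponent of z in the product of all arguments is that of v, namely 1;
    so the words of the product are not constant. *)
Lemma qsh_not_C u v w : zfree u -> (\sum_(e <- v) e.2).1 = 1 -> w \in qsh u v ->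
  Const w = 0.
Proof.
move=> hu hv hw; rewrite /Const; case: ifP => // /in_C_zfree/zfree_arg_sum.
rewrite (qsh_arg_sum hw) /= (zfree_arg_sum hu) hv.
by move=> /eqP.
Qed.

(** * The map phi on stuffle products *)

Lemma phi_C u : in_C u -> pos u -> phi_sym u = << (u, [::]) >>.
Proof.
move=> hu pu; rewrite phiE // partial_zfree ?in_C_zfree // /Const hu.
by rewrite /applyS linear0 add0r.
Qed.

Lemma S_basis_e0 V k x :
  S_basis (rcons V (k, x)) None = << rcons V (k.+1, x) >>.
Proof. by case: V => //= e V; rewrite last_rcons belast_rcons. Qed.

Lemma S_basis_rcons V k (x : arg) m : x.1 = 1 ->
  S_basis (rcons V (k, x)) (Some (- m)) =
  - << rcons (rcons V (k, (0, x.2 - m))) (1%N, (1, m)) >>.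
Proof.
case: x => ? n /= ->; rewrite -[in RHS](opprK m).
by case: V => [|e V] /=; rewrite ?opprK // last_rcons belast_rcons.
Qed.

(** The map id (x) S with the letter o of Omega fixed. *)
Definition idS (o : omega) :
    {malg rat[(sym * sym)%type]} -> {malg rat[(sym * sym)%type]} :=
  linext (fun cw => tens << cw.1 >> (S_basis cw.2 o)).

Lemma idS_U o u v : idS o << (u, v) >> = tens << u >> (S_basis v o).
Proof. exact: linextU. Qed.

Lemma applyS_U f w o : applyS f << (w, o) >> = idS o (f w).
Proof. exact: linextU. Qed.

Lemma applyS_sum f (s : seq sym) (F : sym -> {malg rat[(sym * omega)%type]}) :
  applyS f (\sum_(w <- s) F w) = \sum_(w <- s) applyS f (F w).
Proof. exact: linear_sum. Qed.

Lemma applyS_N f x : applyS f (- x) = - applyS f x.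
Proof. exact: linearN. Qed.

Lemma idS_sum o (s : seq sym) (F : sym -> {malg rat[(sym * sym)%type]}) :
  idS o (\sum_(w <- s) F w) = \sum_(w <- s) idS o (F w).
Proof. exact: linear_sum. Qed.

(** phi(U * V(z)) = U (x) V(z) for U in C and V(z) with z in the last argument
    only. *)
Lemma phi_stuffle_sum U V k (x : arg) : in_C U -> pos U -> zfree V -> pos V ->
    (0 < k)%N -> x.1 = 1 ->
  \sum_(w <- qsh U (rcons V (k, x))) phi_sym w = << (U, rcons V (k, x)) >>.
Proof.
move=> hC pU + + + +; have hU := in_C_zfree hC.
have step V' k' (x' : arg) : zfree V' -> pos V' -> (0 < k')%N -> x'.1 = 1 ->
    \sum_(w <- qsh U (rcons V' (k', x'))) phi_sym w =
    applyS phi_sym (\sum_(w <- qsh U (rcons V' (k', x'))) partial w).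
  move=> zV pV k0 hx; rewrite applyS_sum; apply: eq_big_seq => w hw.
  rewrite phiE; last first.
    by apply: qsh_pos hw; rewrite // posE all_rcons k0 -posE.
  rewrite (qsh_not_C hU _ hw) ?addr0 //.
  by rewrite -cats1 big_cat big_seq1 /= hx zfree_arg_sum // add0r.
have stepI V' k' (x' : arg) : zfree V' -> pos V' -> (0 < k')%N -> x'.1 = 1 ->
    \sum_(w <- qsh U (rcons V' (k', x'))) phi_sym w =
      << (U, rcons V' (k', x')) >> ->
    \sum_(w <- qsh U (rcons V' (k'.+1, x'))) phi_sym w =
      << (U, rcons V' (k'.+1, x')) >>.
  move=> zV pV k0 hx IH; rewrite step //.
  rewrite (@partial_sum_index [::] U V' k' x') // applyS_sum.
  under eq_bigr => w _ do rewrite applyS_U.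
  rewrite -idS_sum IH idS_U S_basis_e0; exact: tensUU.
elim/last_ind: V k x => [|V y IHV].
  elim=> [|[|k] IHk] // [x1 m] zV pV _ /= hx; last first.
    by apply: (stepI [::]) => //; apply: IHk.
  rewrite {x1}hx (step [::]) // (@partial_sum_one m [::]) // absorb_nil tensUU.
  rewrite applyS_N applyS_U phi_C // idS_U /= opprK tensNr opprK; exact: tensUU.
elim=> [|[|k] IHk] // [x1 m] zV pV _ /= hx; last first.
  by apply: stepI => //; apply: IHk.
move: (zV) (pV); rewrite posE /zfree !all_rcons => /andP[/eqP hy zV'] /andP[y0].
rewrite -posE => pV'.
rewrite {x1}hx step // (@partial_sum_merge m [::] U V y) // applyS_sum.
under eq_bigr => w _ do rewrite applyS_N applyS_U.
rewrite sumrN -idS_sum IHV //=; last by rewrite (hy : y.2.1 = 0).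
(* S divides the last argument, which is that of y multiplied by z q^m, by
   z q^m and appends the entry (1, z q^m): this is the original symbol. *)
rewrite idS_U S_basis_rcons /=; last by rewrite (hy : y.2.1 = 0).
rewrite tensNr opprK tensUU addrK.
by rewrite -(hy : y.2.1 = 0); case: (y) => k' [].
Qed.

(** * The maps pi and pi_z *)

(** The index k is positive and the power n of q satisfies 0 <= n <= k. *)
Definition bnd (e : entry) : bool := (0 < e.1)%N && (0 <= qexp e <= e.1%:Z).

(** The polynomial X^n (1 + X)^(k - n) of an entry with index k and power n of
    q; with X = q^m / (1 - q^m) it is q^(n m) / (1 - q^m)^k. *)
Definition epoly (e : entry) : {poly rat} :=
  'X^`|qexp e|%N * ('X + 1) ^+ (e.1 - `|qexp e|%N).

Lemma bnd_abs e : bnd e -> (`|qexp e|%N <= e.1)%N.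
Proof. by case/and3P=> _ h0 h1; rewrite -lez_nat gez0_abs. Qed.

Lemma bnd_adde a c : bnd a -> bnd c -> bnd (adde a c).
Proof.
case/and3P=> a0 a1 a2 /and3P[c0 c1 c2]; apply/and3P; split.
- by rewrite /= addn_gt0 a0.
- by rewrite /qexp /= addr_ge0.
- by rewrite /qexp /= PoszD lerD.
Qed.

Lemma epoly_adde a c : bnd a -> bnd c -> epoly (adde a c) = epoly a * epoly c.
Proof.
move=> ba bc; have [ha hc] := (bnd_abs ba, bnd_abs bc).
have -> : epoly (adde a c) = 'X^(`|qexp a| + `|qexp c|)%N *
    ('X + 1) ^+ ((a.1 + c.1) - (`|qexp a| + `|qexp c|))%N.
  rewrite /epoly.
  suff -> : `|qexp (adde a c)|%N = (`|qexp a| + `|qexp c|)%N by [].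
  case/and3P: ba => _ a1 _; case/and3P: bc => _ c1 _.
  by apply/eqP; rewrite -eqz_nat PoszD !gez0_abs // /qexp /= addr_ge0.
have -> : (a.1 + c.1 - (`|qexp a| + `|qexp c|))%N =
    ((a.1 - `|qexp a|) + (c.1 - `|qexp c|))%N.
  by rewrite subnDA -addnBAC // addnBA.
by rewrite /epoly !exprD mulrACA.
Qed.

Lemma pi_sym_nil : pi_sym [::] = 1.
Proof. by rewrite /pi_sym /Fword big_nil. Qed.

Lemma pi_sym_consE e u : pi_sym (e :: u) =
  (\sum_(s < (e.1 - `|qexp e|).+1) 'C(e.1 - `|qexp e|, s)%:R *: b (e.1 - s))
  * pi_sym u.
Proof. by rewrite /pi_sym /Fword /= big_cons. Qed.

Lemma letter_epoly e : bnd e -> letter (epoly e) =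
  \sum_(s < (e.1 - `|qexp e|).+1) 'C(e.1 - `|qexp e|, s)%:R *: b (e.1 - s).
Proof.
move/bnd_abs=> he; rewrite /epoly exprDn mulr_sumr.
under eq_bigr => s _ do rewrite expr1n mulr1 mulrnAr -exprD -scaler_nat.
rewrite (lin_sum lin_letter); apply: eq_bigr => s _; rewrite letterXn.
congr (_ *: b _); rewrite addnBA ?subnKC //.
by rewrite -ltnS.
Qed.

Lemma pi_sym_cons e u : bnd e -> pi_sym (e :: u) = letter (epoly e) * pi_sym u.
Proof. by move=> he; rewrite letter_epoly // pi_sym_consE. Qed.

(** pi is a morphism from the stuffle product of symbols to that of words. *)
Lemma pi_sym_qsh u v : all bnd u -> all bnd v ->
  \sum_(w <- qsh u v) pi_sym w = stuffle (pi_sym u) (pi_sym v).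
Proof.
elim: u v => [|a u IHu] v.
  by rewrite qsh0s big_seq1 pi_sym_nil stuffle1x.
move=> hau hv; elim: v hv => [|c v IHv].
  by rewrite qshs0 big_seq1 pi_sym_nil stufflex1.
move=> hcv; move: (hau) (hcv) => /= /andP[ha hu] /andP[hc hv].
rewrite qsh_cons !big_cat !big_map.
have cons_sum e s : bnd e ->
    \sum_(w <- s) pi_sym (e :: w) = letter (epoly e) * \sum_(w <- s) pi_sym w.
  by move=> he; rewrite mulr_sumr; apply: eq_bigr => w _; rewrite pi_sym_cons.
rewrite !cons_sum ?bnd_adde // (IHu _ hu hcv) (IHu _ hu hv) (IHv hv).
rewrite (pi_sym_cons _ ha) (pi_sym_cons _ hc) stuffle_letter epoly_adde //.
rewrite /= addrA; reflexivity.
Qed.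

(** * Membership in C and in G *)

(** The condition defining formal symbols on the products x_i ... x_d. *)
Definition suffix_ok (u : sym) : bool :=
  all (fun i => good_prod (\sum_(e <- drop i u) e.2)) (iota 0 (size u)).

Lemma suffix_ok_cons e u :
  suffix_ok (e :: u) = good_prod (\sum_(f <- e :: u) f.2) && suffix_ok u.
Proof.
rewrite /suffix_ok /=; congr (_ && _).
by rewrite (iotaDl 1 0) all_map; apply: eq_all => i.
Qed.

Lemma good_prod_z (x : arg) : x.1 = 1 -> good_prod x.
Proof. by rewrite /good_prod => ->. Qed.

(** An entry satisfying bnd whose argument does not depend on z. *)
Definition cst (e : entry) : bool := bnd e && (zexp e == 0).

(** A symbol of C, described entrywise: as the powers of q are nonnegative, the
    condition on suffixes amounts to a positive power of q in the last entry.
    The default value of last makes the empty symbol admissible. *)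
Definition adm (u : sym) : bool :=
  all cst u && (0 < qexp (last (1%N, (0, 1)) u)).

Lemma adm_cons e u : adm (e :: u) -> adm u.
Proof.
case/andP=> /= /andP[_ hu]; rewrite /adm hu.
by case: u {hu} => //= f u.
Qed.

Lemma adm_sum e u : adm (e :: u) ->
  (\sum_(f <- e :: u) f.2).1 = 0 /\ 0 < (\sum_(f <- e :: u) f.2).2.
Proof.
elim: u e => [|f u IHu] e hu.
  rewrite big_seq1; move: hu; rewrite /adm /= andbT.
  by case/andP=> /andP[_ /eqP he] hq.
have [h1 h2] := IHu f (adm_cons hu).
rewrite big_cons /= h1; case/andP: hu => /= /andP[/andP[be /eqP he] _] _.
split; first by rewrite addr0; exact: he.
by apply: ltr_wpDl h2; case/and3P: be.
Qed.

Lemma adm_suffix_ok u : adm u -> suffix_ok u.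
Proof.
elim: u => [|e u IHu] // hu; rewrite suffix_ok_cons IHu ?(adm_cons hu) // andbT.
by have [h1 h2] := adm_sum hu; rewrite /good_prod h1 h2 orbT.
Qed.

Lemma all_cst u : all cst u -> all bnd u /\ zfree u.
Proof. by move=> h; apply/andP; rewrite -all_predI; exact: h. Qed.

Lemma bnd_in_F n e : bnd e -> zexp e == 0 -> 0 <= qexp e - zexp e * n <= e.1%:Z.
Proof. by case/andP=> _ he /eqP ->; rewrite mul0r subr0. Qed.

Lemma adm_in_C u : adm u -> in_C u.
Proof.
move=> hu; have /andP[hc _] := hu; have [hb hz] := all_cst hc.
rewrite /in_C /in_F_ /in_Fhat -!andbA; apply/and4P; split => //.
- by apply: sub_all hc => e /andP[/andP[-> _] /eqP ->].
- exact: adm_suffix_ok.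
- by apply: sub_all hc => e /andP[be he]; apply: bnd_in_F.
Qed.

Lemma suffix_ok_z V z : zfree V -> zexp z = 1 -> suffix_ok (rcons V z).
Proof.
move=> hV hz; elim: V hV => [|e V IHV] hV.
  by rewrite suffix_ok_cons big_seq1 good_prod_z.
rewrite rcons_cons suffix_ok_cons IHV; last by case/andP: hV.
rewrite andbT good_prod_z // -rcons_cons -cats1 big_cat big_seq1 /=.
by rewrite zfree_arg_sum // add0r; exact: hz.
Qed.

Lemma qsh_suffix_ok U V z w : adm U -> zfree V -> zexp z = 1 ->
  w \in qsh U (rcons V z) -> suffix_ok w.
Proof.
move=> + + hz; elim: U V w => [|c U IHU] V w hU hV.
  by rewrite qsh0s inE => /eqP ->; apply: suffix_ok_z.
elim: V w hV => [|a V IHV] w hV hw.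
  have gw : good_prod (\sum_(e <- w) e.2).
    apply: good_prod_z; rewrite (qsh_arg_sum hw) /= big_seq1.
    by rewrite zfree_arg_sum ?add0r //; case/andP: hU => /all_cst[].
  move: hw gw; rewrite qsh_cons qshs0 qshs0 /= !mem_cat !inE.
  case/or3P => [/mapP[w' hw' ->]|/eqP->|/eqP->];
    rewrite suffix_ok_cons => -> /=.
  - exact: (IHU [::]) (adm_cons hU) isT hw'.
  - exact: adm_suffix_ok.
  - exact/adm_suffix_ok/(adm_cons hU).
have gw : good_prod (\sum_(e <- w) e.2).
  apply: good_prod_z; rewrite (qsh_arg_sum hw) -cats1 big_cat big_seq1 /=.
  rewrite !zfree_arg_sum ?add0r //.
  by case/andP: hU => /all_cst[].
have hV' : zfree V by case/andP: hV.
move: hw gw; rewrite rcons_cons qsh_cons !mem_cat.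
case/or3P => /mapP[w' hw' ->]; rewrite suffix_ok_cons => -> /=.
- exact: (IHU (a :: V)) (adm_cons hU) hV hw'.
- exact: IHV hw'.
- exact: IHU (adm_cons hU) hV' hw'.
Qed.

Lemma qsh_last u v w : all bnd u -> all bnd v -> w \in qsh u v ->
  forall d, 0 < qexp (last d u) -> 0 < qexp (last d v) -> 0 < qexp (last d w).
Proof.
move=> + + hw; move: hw; apply: (qsh_ind (Q := fun u v w => all bnd u ->
  all bnd v -> forall d, 0 < qexp (last d u) -> 0 < qexp (last d v) ->
  0 < qexp (last d w))) => {u v w} //.
- by move=> a c u v w IH /= /andP[_ hu] hv d h1 h2; apply: IH.
- by move=> a c u v w IH /= hu /andP[_ hv] d h1 h2; apply: IH.
- move=> a c u v w IH /= /andP[ha hu] /andP[hc hv] d h1 h2; apply: IH => //.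
  + case: (u) h1 => //= h1; rewrite /qexp /= ltr_wpDr //.
    by case/and3P: hc.
  + case: (v) h2 => //= h2; rewrite /qexp /= ltr_wpDl //.
    by case/and3P: ha.
Qed.

Lemma qsh_in_G U V k n w : adm U -> all cst V -> bnd (k, (1, n)) -> 0 < n ->
  w \in qsh U (rcons V (k, (1, n))) -> in_G w.
Proof.
move=> hU hV hb n0 hw; have /andP[cU lU] := hU.
have [bU zU] := all_cst cU; have [bV zV] := all_cst hV.
have all_w : all (fun e => bnd e && (zexp e \in [:: 0; 1])) w.
  apply: (qsh_all (p := cst) (r := fun e => bnd e && (zexp e \in [:: 0; 1])))
    cU _ hw => //.
  - by move=> a /andP[-> /eqP->].
  - move=> a c /andP[ba /eqP za] /andP[bc zc]; rewrite bnd_adde //.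
    by rewrite [zexp _](_ : _ = zexp c) // /zexp /= (za : a.2.1 = 0) add0r.
  - rewrite all_rcons hb /=.
    by apply: sub_all hV => e /andP[-> /eqP->].
have bw : all bnd w by apply: sub_all all_w => e /andP[].
rewrite /in_G /in_F_ /in_Fhat -!andbA; apply/and4P; split.
- apply: sub_all all_w => e /andP[/andP[-> _]].
  by rewrite !inE => /orP[]/eqP ->.
- exact: qsh_suffix_ok hw.
- apply: sub_all all_w => e /andP[/andP[_ he] _].
  by rewrite mulr0 subr0.
have := qsh_last bU _ hw lU; rewrite last_rcons all_rcons hb bV => /(_ isT n0).
case: (w) => //= e w'; case: (last e w') => k' [h' n'] /= n'0.
by rewrite xpair_eqE /= negb_and (gt_eqF n'0) orbT.
Qed.

(** If the last power of q is positive, then no word of pi u ends with b_0.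
    The default value d stands for the letter preceding the word, which is
    its last letter when u is empty. *)
Lemma pi_sym_supp d u : all bnd u -> 0 < qexp (last (1%N, (0, d%:Z)) u) ->
  supp_in (fun w : word => last d w != 0%N) (pi_sym u).
Proof.
elim: u d => [|e u IHu] d.
  rewrite pi_sym_nil -wd1 /= /qexp /= ltz_nat lt0n => _ hd; exact: supp_inU.
move=> /= /andP[he hu] hq; rewrite pi_sym_consE mulr_suml.
apply: supp_in_sum => s _; rewrite -scalerAl; apply/supp_inZ/supp_in_bM.
suff h : 0 < qexp (last (1%N, (0, (e.1 - s)%N%:Z)) u).
  by move=> w /(IHu _ hu h); rewrite fmM fmU.
case: u hq {IHu hu} => //=; rewrite /qexp /= => hq; rewrite ltz_nat subn_gt0.
have := ltn_ord s; move: (nat_of_ord s) => i; rewrite /qexp.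
case/and3P: he => _ _; rewrite /qexp; move: (e.2.2) hq => n; lia.
Qed.

(** * Surjectivity of pi *)

Lemma pi_U u : pi << u >> = pi_sym u.
Proof. exact: linextU. Qed.

Lemma lin_pi : lin pi.
Proof. exact: lin_linext. Qed.

Lemma piB x y : pi (x - y) = pi x - pi y.
Proof. exact: linearB. Qed.

Lemma piD x y : pi (x + y) = pi x + pi y.
Proof. exact: linearD. Qed.

Lemma piZ c x : pi (c *: x) = c *: pi x.
Proof. exact: linearZ. Qed.

Lemma pi0 : pi 0 = 0.
Proof. exact: linear0. Qed.

(** Insertion of a first entry. *)
Definition lcons (e : entry) : {malg rat[sym]} -> {malg rat[sym]} :=
  linext (fun u => << e :: u >>).

Lemma pi_lcons e y : bnd e -> pi (lcons e y) = letter (epoly e) * pi y.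
Proof.
move=> he; move: y.
apply: (@lin_ext _ _ (fun y => pi (lcons e y))
  (fun y => letter (epoly e) * pi y)).
- exact: (lin_comp lin_pi (lin_linext _)).
- exact: (lin_mull _ lin_pi).
move=> u; rewrite /lcons [linext _ _]linextU !pi_U pi_sym_cons //.
Qed.

(** Nonempty symbols are needed in the induction: an entry such as (1, 1) can
    only be put in front of a nonempty symbol. *)
Definition adm1 (u : sym) : bool := (u != [::]) && adm u.

Lemma adm1_cons e u : cst e -> adm1 u -> adm1 (e :: u).
Proof.
move=> he /andP[u0 /andP[hu hl]]; apply/andP; split => //.
rewrite /adm /= he hu; by case: u u0 hl {hu} => // f u _.
Qed.

Lemma supp_in_lcons e y : cst e -> supp_in adm1 y -> supp_in adm1 (lcons e y).
Proof.
move=> he hy; apply: supp_in_linext hy _ => u hu.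
exact/supp_inU/adm1_cons.
Qed.

Lemma letterB p q : letter (p - q) = letter p - letter q.
Proof.
rewrite -(scaleN1r q) (addrC p) lin_letter scaleN1r (addrC _ (letter p)).
reflexivity.
Qed.

Lemma pi_lconsB e f y : bnd e -> bnd f ->
  pi (lcons e y - lcons f y) = letter (epoly e - epoly f) * pi y.
Proof.
by move=> he hf; rewrite piB letterB mulrBl; congr (_ - _); apply: pi_lcons.
Qed.

Lemma pi_surj_word i s : last i s != 0%N ->
  exists2 y, supp_in adm1 y & pi y = wd (i :: s).
Proof.
elim: s i => [|j s IHs] i /=.
  rewrite -lt0n => i0; exists << [:: (i, (0, i%:Z))] >>.
    by apply: supp_inU; rewrite /adm1 /adm /cst /bnd /qexp /= i0 lexx.
  have hb : bnd (i, (0, i%:Z)) by rewrite /bnd /qexp /= i0 lexx.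
  rewrite pi_U (pi_sym_cons _ hb).
  rewrite /epoly /qexp /= subnn mulr1 letterXn pi_sym_nil mulr1; exact: bE.
move=> /IHs[y hy py]; case: (posnP i) => [->|i0].
  (* b_0 is the constant polynomial 1 = (X + 1) - X. *)
  exists (lcons (1%N, (0, 0)) y - lcons (1%N, (0, 1)) y).
    by apply: supp_inD; [|apply: supp_inN]; apply: supp_in_lcons.
  apply: (etrans (@pi_lconsB (1%N, (0, 0)) (1%N, (0, 1)) y isT isT)).
  rewrite py -(b_wd 0) -letterXn; congr (letter _ * _).
  rewrite /epoly /qexp /= subn0 subnn !expr1 !expr0 mulr1 mul1r.
  by rewrite addrC addKr.
have hb : bnd (i, (0, i%:Z)) by rewrite /bnd /qexp /= i0 lexx.
exists (lcons (i, (0, i%:Z)) y).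
  by apply: supp_in_lcons => //; rewrite /cst hb.
rewrite (pi_lcons y hb) py /epoly /qexp /= subnn mulr1 letterXn b_wd.
reflexivity.
Qed.

Lemma pi_surj (x : QB) : x \in QB0 -> exists2 y, supp_in adm y & pi y = x.
Proof.
move/QB0P => hx; rewrite [x]malg_sum.
pose S z := exists2 y, supp_in adm y & pi y = z.
rewrite big_seq; apply: (big_ind S).
- by exists 0; [exact: supp_in0 | exact: pi0].
- move=> _ _ [y hy <-] [y' hy' <-]; exists (y + y'); first exact: supp_inD.
  exact: piD.
move=> k; rewrite -mcoeff_neq0 => /hx kadm.
suff [y hy py] : S (wd k).
  exists (x@_k *: y); first exact: supp_inZ.
  by rewrite piZ py /wd fmK.
case: (fmonom_val k) (kadm : last 1%N (fmonom_val k) != 0%N) => [_|i s /= hs].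
  by exists << [::] >>; [apply: supp_inU | rewrite pi_U pi_sym_nil wd1].
have [y hy py] := pi_surj_word hs; exists y => // u /hy.
by case/andP.
Qed.

(** * The ideal of confluence relations *)

Section Ideal.
Variables (R : comNzRingType) (gen : R -> Prop).

Lemma in_ideal0 : in_ideal gen 0.
Proof. by exists [::]; rewrite big_nil. Qed.

Lemma in_idealD x y : in_ideal gen x -> in_ideal gen y -> in_ideal gen (x + y).
Proof.
move=> [s [hs ->]] [t [ht ->]]; exists (s ++ t); rewrite big_cat; split=> // p.
by rewrite mem_cat => /orP[/hs|/ht].
Qed.

Lemma in_idealM a x : in_ideal gen x -> in_ideal gen (a * x).
Proof.
move=> [s [hs ->]]; exists [seq (a * p.1, p.2) | p <- s]; split.
  by move=> p /mapP[p' /hs h ->].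
by rewrite big_map mulr_sumr; apply: eq_bigr => p _; rewrite mulrA.
Qed.

Lemma in_ideal_gen x : gen x -> in_ideal gen x.
Proof.
move=> hx; exists [:: (1, x)]; split; last by rewrite big_seq1 mul1r.
by move=> p; rewrite inE => /eqP ->.
Qed.

End Ideal.

Lemma I_CF_sum (I : eqType) (r : seq I) (c : I -> rat) (F : I -> SymQB0) :
  {in r, forall i, I_CF (F i)} -> I_CF (\sum_(i <- r) c i *: F i).
Proof.
move=> hF; rewrite big_seq; apply: (big_ind I_CF).
- exact: in_ideal0.
- exact: in_idealD.
- by move=> i /hF h; rewrite -mul_malgC; apply: in_idealM.
Qed.

(** * Evaluating the relations *)

Lemma lin_inS : lin inS.
Proof. exact: lin_linext. Qed.

Lemma inS_wordE (w : word) : inS << w >> = inS_word w.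
Proof. exact: linextU. Qed.

Lemma inS_sum (x : QB) : inS x = \sum_(k <- msupp x) x@_k *: inS << k >>.
Proof. by apply: eq_bigr => k _; rewrite inS_wordE. Qed.

(** reg is not known to be linear, but it is the identity on every word of y. *)
Lemma m_odot_reg (x y : QB) : y \in QB0 ->
  m_odot (tensmap id reg (tens x y)) = inS x * inS y.
Proof.
move=> /QB0P hy; rewrite (inS_sum x) (inS_sum y).
have lF : lin (fun t => m_odot (tensmap id reg t)).
  exact: (lin_comp (lin_linext _) (lin_linext _)).
have -> : tens x y = \sum_(k <- msupp x) \sum_(l <- msupp y)
    (x@_k * y@_l) *: << (k, l) >>.
  by apply: eq_bigr => k _; apply: eq_bigr => l _; apply: malgUZ.
under eq_bigr => k _ do rewrite -[\sum_(l <- _) _]scale1r.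
rewrite (lin_sum lF) mulr_suml; apply: eq_bigr => k _.
rewrite scale1r (lin_sum lF) mulr_sumr; apply: eq_big_seq => l.
rewrite -mcoeff_neq0 => /hy hl.
rewrite -scalerAl -scalerAr scalerA; congr (_ *: _).
have rl : reg << l >> = << l >>.
  by apply: reg_QB0; apply/QB0P; apply: supp_inU.
have -> : tensmap id reg << (k, l) >> = << (k, l) >>.
  by rewrite /tensmap [LHS]linextU /= rl tensUU.
exact: linextU.
Qed.

Lemma in_QG (s : seq sym) : all in_G s -> \sum_(w <- s) << w >> \in QG.
Proof.
move=> /allP hs; apply/allP => w; rewrite -mcoeff_neq0 => hw.
have /(_ w hw) // : supp_in in_G (\sum_(v <- s) << v >> : {malg rat[sym]}).
by apply: supp_in_sum => v /hs; apply: supp_inU.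
Qed.

(** The confluence relation of U * W, where W has z in its last argument. *)
Lemma confluence_stuffle U V k n : adm U -> all cst V ->
    bnd (k, (1, n)) -> 0 < n ->
  let W := rcons V (k, (1, n)) in
  I_CF (inS (pi_sym U) * inS (pi_sym W)
        - inS (stuffle (pi_sym U) (pi_sym W))).
Proof.
move=> hU hV hb n0 W; have /andP[cU lU] := hU.
have [bU zU] := all_cst cU; have [bV zV] := all_cst hV.
have bW : all bnd W by rewrite all_rcons hb.
have pos_bnd u : all bnd u -> pos u.
  by rewrite posE; apply: sub_all => e /andP[].
have hG : \sum_(w <- qsh U W) << w >> \in QG.
  by apply: in_QG; apply/allP => w; apply: qsh_in_G.
have := in_ideal_gen (CF_confl hG).
have -> : pi (eval_z1 (\sum_(w <- qsh U W) << w >>))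
        = stuffle (pi_sym U) (pi_sym W).
  rewrite -pi_sym_qsh // /eval_z1 linear_sum /Defs.pi linear_sum.
  apply: eq_bigr => w _; rewrite /= [linext _ << w >>]linextU [LHS]linextU.
  by rewrite /pi_sym -map_comp.
suff -> : phi_pi (\sum_(w <- qsh U W) << w >>) = tens (pi_sym U) (pi_sym W).
  rewrite m_odot_reg //; apply/QB0P.
  apply: (@pi_sym_supp 1%N) => //.
  by rewrite last_rcons.
rewrite /phi_pi.
have -> : phi (\sum_(w <- qsh U W) << w >>) = << (U, W) >>.
  rewrite /phi linear_sum /=; under eq_bigr => w _ do rewrite linextU.
  apply: phi_stuffle_sum => //; try exact: pos_bnd; first exact: adm_in_C.
  by case/andP: hb.
rewrite /tensmap [LHS]linextU /=; congr tens; exact: linextU.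
Qed.

Lemma confluence_adm U V : adm U -> adm V ->
  I_CF (inS (pi_sym U) * inS (pi_sym V)
        - inS (stuffle (pi_sym U) (pi_sym V))).
Proof.
move=> hU; case/lastP: V => [|V [k [h n]]] hV.
  (* For V empty the relation is a multiple of the generator equating units. *)
  rewrite pi_sym_nil stufflex1 -[X in _ - X]mulr1 -mulrBr.
  exact/in_idealM/in_ideal_gen/CF_unit.
move: hV; rewrite /adm all_rcons last_rcons => /andP[/andP[hk hV] n0].
(* The formula of pi_sym does not see the exponents of z. *)
have -> : pi_sym (rcons V (k, (h, n))) = pi_sym (rcons V (k, (1, n))).
  by rewrite /pi_sym !map_rcons.
by apply: confluence_stuffle; rewrite //; case/andP: hk.
Qed.

Theorem theorem32 (u v : QB) (hu : u \in QB0) (hv : v \in QB0) :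
  I_CF (inS u * inS v - inS (stuffle u v)).
Proof.
have [x hx <-] := pi_surj hu; have [y hy <-] := pi_surj hv.
pose T (s t : QB) := inS s * inS t - inS (stuffle s t).
have Tl t : lin (T^~ t).
  move=> c s s'; rewrite /T lin_stuffle_l !lin_inS mulrDl -scalerAl.
  by rewrite opprD addrACA scalerBr.
have Tr s : lin (T s).
  move=> c t t'; rewrite /T lin_stuffle !lin_inS mulrDr -scalerAr.
  by rewrite opprD addrACA scalerBr.
rewrite -[X in I_CF X]/(T (pi x) (pi y)).
have piE t : pi t = \sum_(w <- msupp t) t@_w *: pi_sym w by [].
rewrite (piE x) (lin_sum (Tl _)); apply: I_CF_sum => U.
rewrite -mcoeff_neq0 => /hx aU.
rewrite (piE y) (lin_sum (Tr _)); apply: I_CF_sum => V.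
rewrite -mcoeff_neq0 => /hy aV; exact: confluence_adm.
Qed.
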